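(* Consider a networked system with graph $\mathcal G=(\mathcal V,\mathcal E)$ and matrices $A,B,Q,R$ as in the context. Suppose there are $L>1$, $\alpha\in(0,1)$, $\gamma\in(0,1)$ such that (a) $\|A\|,\|B\|,\|Q\|,\|R\|\le L$; (b) $R\succeq\gamma I$; (c) $(A,B)$ is $(L,\alpha)$-stabilizable; (d) $Q\succeq 0$ and $(A,Q^{1/2})$ is $(L,\alpha)$-detectable. Suppose also that $p$ is a subexponential function with $|\{j\in\mathcal V: d_{\mathcal G}(i,j)=d\}|\le p(d)$ for all $i\in\mathcal V$ and all integers $d\ge0$. Let $\pi^\star(x)=-K^\star x$ be the optimal LQR policy and $\pi^\kappa(x)=-K^\kappa x$ the $\kappa$-distributed policy. If $\kappa\ge0$ is an integer with $\kappa\ge\overline\kappa$, then for every initial state $\overline x$, $$J(\pi^\kappa(\cdot);\overline x)-J(\pi^\star(\cdot);\overline x)\le\Gamma\,\delta^\kappa\,\|\overline x\|^2,$$ where $$\Gamma:=\frac{\Omega^2L\Psi\big((1+LL_P)(2L_PL^2/\gamma+\Psi)+2LL_P\big)}{1-\beta^2}$$ and $L_P,\delta,\Psi,\beta,\Omega,\overline\kappa$ are the constants defined in the context.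
   Context: Setting. $\mathcal G=(\mathcal V,\mathcal E)$ is a finite undirected graph without self-loops, $\mathcal V=\{1,\dots,N\}$; $d_{\mathcal G}(i,j)$ is the number of edges in a shortest path from $i$ to $j$ ($+\infty$ if there is no path). Each node $i$ has a state $x_i(t)\in\mathbb R^{n_{x_i}}$ and control $u_i(t)\in\mathbb R^{n_{u_i}}$. Real blocks $A_{ij}\in\mathbb R^{n_{x_i}\times n_{x_j}}$, $B_{ij}\in\mathbb R^{n_{x_i}\times n_{u_j}}$, $Q_{ij}\in\mathbb R^{n_{x_i}\times n_{x_j}}$, $R_{ij}\in\mathbb R^{n_{u_i}\times n_{u_j}}$ are given, with $Q_{ij}=Q_{ji}^\top$, $R_{ij}=R_{ji}^\top$, and all four blocks equal to zero whenever $i\ne j$ and $\{i,j\}\notin\mathcal E$. Set $A=\{A_{ij}\}$, $B=\{B_{ij}\}$, $Q=\{Q_{ij}\}$, $R=\{R_{ij}\}$ (block matrices indexed by $i,j\in\mathcal V$), $x=\{x_i\}_{i\in\mathcal V}$, $u=\{u_i\}_{i\in\mathcal V}$. $\|\cdot\|$ is the Euclidean norm for vectors and the induced 2-norm for matrices; $M\succeq M'$ means $M-M'$ is positive semidefinite. A function $p:\mathbb Z_{\ge0}\to[0,\infty)$ is subexponential if $p(d)r^d\to0$ as $d\to\infty$ for every $r\in(0,1)$. Stability notions, for $L>0$, $\alpha\in[0,1)$: a square matrix $\Phi$ is $(L,\alpha)$-stable if $\|\Phi^t\|\le L\alpha^t$ for all integers $t\ge 0$; $(A,B)$ is $(L,\alpha)$-stabilizable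 if there is $\overline K$ with $\|\overline K\|\le L$ and $A-B\overline K$ $(L,\alpha)$-stable; $(A,C)$ is $(L,\alpha)$-detectable if $(A^\top,C^\top)$ is $(L,\alpha)$-stabilizable. Linear-quadratic regulator (LQR): minimize $\sum_{t=0}^\infty \tfrac12 x(t)^\top Qx(t)+\tfrac12u(t)^\top Ru(t)$ subject to $x(0)=\overline x$, $x(t+1)=Ax(t)+Bu(t)$ for $t\ge0$. The optimal policy is the linear feedback $u=-K^\star x$; explicitly $K^\star=(R+B^\top P^\star B)^{-1}B^\top P^\star A$, where $P^\star$ is the unique positive semidefinite solution of $P=A^\top PA-A^\top PB(R+B^\top PB)^{-1}B^\top PA+Q$. $K^\star$ is partitioned into blocks $K^\star_{ij}\in\mathbb R^{n_{u_i}\times n_{x_j}}$. The $\kappa$-truncated gain $K^\kappa=\{K^\kappa_{ij}\}$ has $K^\kappa_{ij}=K^\star_{ij}$ if $d_{\mathcal G}(i,j)\le\kappa$ and $K^\kappa_{ij}=0$ otherwise. Closed-loop performance index: for a policy $\pi(\cdot)$ and initial state $\overline x$, $J(\pi(\cdot);\overline x):=\sum_{t=0}^\infty\tfrac12x(t)^\top Qx(t)+\tfrac12u(t)^\top Ru(t)$, where $x(0)=\overline x$, $u(t)=\pi(x(t))$, $x(t+1)=Ax(t)+Bu(t)$. Constants (in terms of $L,\alpha,\gamma,p$): $\gamma_F=\frac{(1-\alpha)^2}{L^2(1+L)^2}$, $\gamma_G=\frac{(1-\alpha)^2\gamma}{2L^4(1+L)^2}$, $L_P=\frac{L^3(1+L^2)}{1-\alpha^2}$,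 $L_H=\max(2L+1,\,L_P+1)$, $\overline\mu=\big(2L_H^2/\gamma_G+\gamma_G+L_H\big)/\gamma_F$, $\gamma_H=\Big(\frac{2}{\gamma_G}+\big(1+\frac{4L_H}{\gamma_G}+\frac{4L_H^2}{\gamma_G^2}\big)\frac{L_H(1+\overline\mu L_H)}{\gamma_F}+\overline\mu\Big)^{-1}$, $\rho=\Big(\frac{L_H^2-\gamma_H^2}{L_H^2+\gamma_H^2}\Big)^{1/2}$, $\Upsilon=\frac{L_H}{\gamma_H^2\,\rho}$, $\delta=\frac{\rho+1}{2}$, $\Psi=\big(\sup_{d\in\mathbb Z_{\ge0}}p(d)(\rho/\delta)^d\big)\frac{\Upsilon\delta}{1-\delta}$, $\beta=\big(1-\frac{1-\rho^2}{2\Upsilon^2}\big)^{1/2}$, $\Omega=\big(\frac{\Upsilon^2}{1-\rho^2}\big)^{1/2}$, $\overline\kappa=\frac{1}{\log\delta}\log\Big(\frac{1-\rho^2}{2\Upsilon^2\Psi L(L\Psi+2L(1+L_PL^2/\gamma))}\Big)$. *)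

(* Defs.v *)
From mathcomp Require Import all_boot all_order all_algebra.
From mathcomp Require Import all_classical all_reals all_analysis.

Set Implicit Arguments.
Unset Strict Implicit.
Unset Printing Implicit Defensive.

Import Order.TTheory GRing.Theory Num.Theory.
Import numFieldNormedType.Exports.
Local Open Scope classical_set_scope.
Local Open Scope ring_scope.

Section Norms.
Context {F : realType}.

Definition norm2 n (v : 'cV[F]_n) : F := Num.sqrt (\sum_i v i 0 ^+ 2).

Definition opnorm m n (M : 'M[F]_(m, n)) : F :=
  sup [set norm2 (M *m v) | v in [set v : 'cV[F]_n | norm2 v <= 1]].

Definition psd n (M : 'M[F]_n) : Prop :=
  M^T = M /\ forall v : 'cV[F]_n, 0 <= (v^T *m M *m v) 0 0.

Definition loewner_ge n (M M' : 'M[F]_n) : Prop := psd (M - M').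

(* S is the square root M^{1/2}, i.e. the unique positive semidefinite matrix
   whose square is M *)
Definition is_sqrtm n (M S : 'M[F]_n) : Prop := psd S /\ S *m S = M.

End Norms.

Section Graph.
Context (F : realType) {N : nat} (e : rel 'I_N).

(* The infimum of the empty set is +oo, the value for unconnected vertices. *)
Definition gdist (i j : 'I_N) : \bar F :=
  ereal_inf [set (size w)%:R%:E | w in [set w | path e i w /\ last i w = j]].

End Graph.

Section Stability.
Context {F : realType}.

Definition subexponential (p : nat -> F) : Prop :=
  (forall d, 0 <= p d) /\
  (forall r : F, 0 < r < 1 -> p d * r ^+ d @[d --> \oo] --> (0 : F)).

Definition stable (L a : F) n (Phi : 'M[F]_n) : Prop :=
  forall t : nat, opnorm (Phi ^+ t) <= L * a ^+ t.

Definition stabilizable (L a : F) n m (A : 'M[F]_n) (B : 'M[F]_(n, m)) : Prop :=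
  exists2 K : 'M[F]_(m, n), opnorm K <= L & stable L a (A - B *m K).

Definition detectable (L a : F) n m (A : 'M[F]_n) (C : 'M[F]_(m, n)) : Prop :=
  stabilizable L a A^T C^T.

End Stability.

Section LQR.
Context {F : realType} {n m : nat}.
Variables (A : 'M[F]_n) (B : 'M[F]_(n, m)) (Q : 'M[F]_n) (R : 'M[F]_m).

Definition riccati (P : 'M[F]_n) : Prop :=
  P = A^T *m P *m A
      - A^T *m P *m B *m invmx (R + B^T *m P *m B) *m B^T *m P *m A + Q.

Definition lqr_gain (P : 'M[F]_n) : 'M[F]_(m, n) :=
  invmx (R + B^T *m P *m B) *m B^T *m P *m A.

Definition linear_policy (K : 'M[F]_(m, n)) (x : 'cV[F]_n) : 'cV[F]_m :=
  - (K *m x).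

Fixpoint state (pi : 'cV[F]_n -> 'cV[F]_m) (x0 : 'cV[F]_n) (t : nat)
    : 'cV[F]_n :=
  if t is s.+1 then A *m state pi x0 s + B *m pi (state pi x0 s) else x0.

Definition stage_cost (x : 'cV[F]_n) (u : 'cV[F]_m) : F :=
  2^-1 * (x^T *m Q *m x) 0 0 + 2^-1 * (u^T *m R *m u) 0 0.

(* Extended-real valued: for Q and R positive semidefinite the stage costs are
   nonnegative, and the cost of a policy that is not stabilizing may be +oo. *)
Definition J (pi : 'cV[F]_n -> 'cV[F]_m) (x0 : 'cV[F]_n) : \bar F :=
  (\sum_(0 <= t <oo)
     (stage_cost (state pi x0 t) (pi (state pi x0 t)))%:E)%E.

End LQR.

Definition truncated_gain (F : realType) (N : nat) (e : rel 'I_N)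
    (nx nu : 'I_N -> nat) (kappa : nat)
    (K : 'M[F]_(\sum_i nu i, \sum_i nx i)) :
    'M[F]_(\sum_i nu i, \sum_i nx i) :=
  \mxblock_(i, j)
    (if (gdist F e i j <= kappa%:R%:E)%E then submxblock K i j else 0).

Section Constants.
Context {F : realType}.
Variables (L a g : F) (p : nat -> F).

Definition gammaF : F := (1 - a) ^+ 2 / (L ^+ 2 * (1 + L) ^+ 2).
Definition gammaG : F := (1 - a) ^+ 2 * g / (2 * L ^+ 4 * (1 + L) ^+ 2).
Definition LP : F := L ^+ 3 * (1 + L ^+ 2) / (1 - a ^+ 2).
Definition LH : F := Num.max (2 * L + 1) (LP + 1).
Definition mubar : F := (2 * LH ^+ 2 / gammaG + gammaG + LH) / gammaF.
Definition gammaH : F :=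
  (2 / gammaG
   + (1 + 4 * LH / gammaG + 4 * LH ^+ 2 / gammaG ^+ 2)
     * (LH * (1 + mubar * LH) / gammaF)
   + mubar)^-1.
Definition rho : F :=
  Num.sqrt ((LH ^+ 2 - gammaH ^+ 2) / (LH ^+ 2 + gammaH ^+ 2)).
Definition Upsilon : F := LH / (gammaH ^+ 2 * rho).
Definition delta : F := (rho + 1) / 2.
Definition Psi : F :=
  sup (range (fun d : nat => p d * (rho / delta) ^+ d))
  * (Upsilon * delta / (1 - delta)).
Definition beta : F := Num.sqrt (1 - (1 - rho ^+ 2) / (2 * Upsilon ^+ 2)).
Definition Omega : F := Num.sqrt (Upsilon ^+ 2 / (1 - rho ^+ 2)).
Definition kappabar : F :=
  (ln delta)^-1
  * ln ((1 - rho ^+ 2)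
        / (2 * Upsilon ^+ 2 * Psi * L
           * (L * Psi + 2 * L * (1 + LP * L ^+ 2 / g)))).
Definition Gamma : F :=
  Omega ^+ 2 * L * Psi
  * ((1 + L * LP) * (2 * LP * L ^+ 2 / g + Psi) + 2 * L * LP)
  / (1 - beta ^+ 2).

End Constants.

(* Main.v *)
(* The optimal trajectory (x, u, l) = (Phi^t x0, - K Phi^t x0, - P Phi^t x0),
   with Phi = A - B K, solves the KKT system H v = b of the LQR problem on a
   finite horizon with terminal cost P, where b only records x0.  H is
   self-adjoint, couples only neighbouring nodes and times, and satisfies
   3 gammaH |v| <= |H v| <= 3 LH |v|: the lower bound follows from
   detectability (for x), stabilizability (for l, backwards in time) and the
   energy identity <H v, (x, u, - l)> = sum_t (x'Qx + u'Ru) + x(T)'P x(T).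
   Hence k steps of the iteration w + c H (b - H w), which contracts the error
   by rho^2 per step, reach only distance 2k from the support of b, so that
   the blocks K_ij and the powers Phi^t decay like rho^d(i,j) and rho^t.

   By the Schur test the truncated gain then differs from K by at most
   Psi delta^kappa, and y |-> sum_(t < M) |Phi^t y|^2 remains a Lyapunov
   function of the truncated loop.  Completing the square in the Riccati
   equation expresses the cost gap as 1/2 sum_t |E x(t)|^2 in the norm of
   R + B'PB, with E = K - K^kappa, which is of order Psi^2 delta^(2 kappa). *)

From HB Require Import structures.
Require Import Defs.
From mathcomp Require Import all_boot all_order all_algebra.
From mathcomp Require Import all_classical all_reals all_analysis.
From mathcomp Require Import ring lra.

Set Implicit Arguments.
Unset Strict Implicit.
Unset Printing Implicit Defensive.

Import Order.TTheory GRing.Theory Num.Theory.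
Import numFieldNormedType.Exports.
Local Open Scope classical_set_scope.
Local Open Scope ring_scope.

(** * Semi-inner products and local approximation of inverses *)

(** The obstacle is that [P] is dense, so no locality can be read off from the formula for the gain.
    In the KKT system [P] occurs only in the terminal row, which a local iteration started from data
    at time 0 does not reach before the horizon; and with this terminal weight the optimal
    trajectory solves the finite problem exactly, so no passage to an infinite horizon is needed.
    The bounds on H do not depend on the horizon, which may therefore grow with the number of
    iterations.

    H is indefinite, being a saddle-point operator, so the iteration works with H^2; this is why
    rho^2 has the form (h^2 - l^2) / (h^2 + l^2) for a lower bound l and an upper bound h on H. The
    factor 3 in both bounds cancels in this quotient.

    The lower bound on kappa keeps the truncated loop stable. Once this is secured, the cost gap is
    quadratic in the truncation error, hence below the rate delta^kappa of the theorem. *)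

Lemma ler_of_eq (F : numDomainType) (x y : F) : x = y -> x <= y.
Proof. by move=> ->. Qed.

Section SemiInnerProduct.
Context {F : realType} {V : lmodType F}.

(** Definiteness is not asked for: the product [tip] of trajectories ignores all entries beyond the
    horizon, and the form of a positive semidefinite matrix may degenerate. *)
Definition semi_inner (ip : V -> V -> F) : Prop :=
  [/\ forall x y, ip x y = ip y x,
      forall c x y z, ip (c *: x + y) z = c * ip x z + ip y z
    & forall x, 0 <= ip x x].

Variables (ip : V -> V -> F).
Hypothesis ipP : semi_inner ip.

Lemma ipC x y : ip x y = ip y x. Proof. by case: ipP. Qed.
Lemma ip_ge0 x : 0 <= ip x x. Proof. by case: ipP. Qed.
Lemma ipPl c x y z : ip (c *: x + y) z = c * ip x z + ip y z.
Proof. by case: ipP. Qed.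
Lemma ipDl x y z : ip (x + y) z = ip x z + ip y z.
Proof. by rewrite -{1}[x]scale1r ipPl mul1r. Qed.
Lemma ipDr x y z : ip z (x + y) = ip z x + ip z y.
Proof. by rewrite ![ip z _]ipC ipDl. Qed.
Lemma ip0l z : ip 0 z = 0.
Proof. by have := ipDl 0 0 z; rewrite addr0 => h; lra. Qed.
Lemma ipZl c x z : ip (c *: x) z = c * ip x z.
Proof. by rewrite -[c *: x]addr0 ipPl ip0l addr0. Qed.
Lemma ipZr c x z : ip z (c *: x) = c * ip z x.
Proof. by rewrite ![ip z _]ipC ipZl. Qed.
Lemma ipNl x z : ip (- x) z = - ip x z.
Proof. by rewrite -scaleN1r ipZl mulN1r. Qed.
Lemma ipNr x z : ip z (- x) = - ip z x.
Proof. by rewrite -scaleN1r ipZr mulN1r. Qed.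

Lemma ip_CS x y : ip x y ^+ 2 <= ip x x * ip y y.
Proof.
have main s : 0 <= ip x x - 2 * s * ip x y + s ^+ 2 * ip y y.
  have := ip_ge0 (x - s *: y).
  rewrite ipDl !ipDr !ipNl !ipNr !ipZl !ipZr (ipC y x).
  by congr (_ <= _); ring.
have := ip_ge0 y; rewrite le_eqVlt => /predU1P[y0|y0].
  have [->|z0] := eqVneq (ip x y) 0; first by rewrite expr0n -y0 mulr0.
  (* For [y] of length 0 the quadratic in [s] is affine; at this [s] it takes the value -1. *)
  have := main ((ip x x + 1) / (2 * ip x y)).
  have -> : 2 * ((ip x x + 1) / (2 * ip x y)) * ip x y = ip x x + 1 by field.
  by rewrite -y0; lra.
have := main (ip x y / ip y y).
rewrite -(pmulr_lge0 _ y0).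
have -> : (ip x x - 2 * (ip x y / ip y y) * ip x y
   + (ip x y / ip y y) ^+ 2 * ip y y) * ip y y
   = ip x x * ip y y - ip x y ^+ 2 by field; rewrite gt_eqF.
by rewrite subr_ge0.
Qed.

Definition snorm x := Num.sqrt (ip x x).

Lemma snorm_ge0 x : 0 <= snorm x. Proof. exact: sqrtr_ge0. Qed.
Lemma sqr_snorm x : snorm x ^+ 2 = ip x x.
Proof. by rewrite sqr_sqrtr ?ip_ge0. Qed.

Lemma normr_ip x y : `|ip x y| <= snorm x * snorm y.
Proof.
rewrite -(@ler_pXn2r _ 2%N) ?nnegrE ?mulr_ge0 ?snorm_ge0//.
by rewrite real_normK ?num_real// exprMn !sqr_snorm ip_CS.
Qed.

Lemma ip_le x y : ip x y <= snorm x * snorm y.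
Proof. exact: le_trans (ler_norm _) (normr_ip x y). Qed.

Lemma snormD x y : snorm (x + y) <= snorm x + snorm y.
Proof.
rewrite -(@ler_pXn2r _ 2%N) ?nnegrE ?addr_ge0 ?snorm_ge0//.
rewrite sqr_snorm ipDl !ipDr (ipC y x) sqrrD !sqr_snorm.
by have := ip_le x y; lra.
Qed.

Lemma snormZ c x : snorm (c *: x) = `|c| * snorm x.
Proof.
rewrite /snorm ipZl ipZr mulrA -expr2 sqrtrM ?sqr_ge0//.
by rewrite sqrtr_sqr.
Qed.

Lemma snormN x : snorm (- x) = snorm x.
Proof. by rewrite -scaleN1r snormZ normrN1 mul1r. Qed.

Lemma snormB x y : snorm (x - y) <= snorm x + snorm y.
Proof. by rewrite -(snormN y) snormD. Qed.

(* Polarization: 4<Mx,y> = <M(x+y),x+y> - <M(x-y),x-y>, applied to y = Mx/q. *)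
Lemma selfadjoint_contraction (M : V -> V) (q : F) : 0 < q ->
  (forall c x y, M (c *: x + y) = c *: M x + M y) ->
  (forall x y, ip (M x) y = ip x (M y)) ->
  (forall x, `|ip (M x) x| <= q * ip x x) ->
  forall x, ip (M x) (M x) <= q ^+ 2 * ip x x.
Proof.
move=> q0 Mlin Msa Mq x.
have MZ c y : M (c *: y) = c *: M y.
  have M0 : M 0 = 0.
    have := Mlin 1 0 0; rewrite scaler0 scale1r addr0 => h.
    by apply: (@addIr _ (M 0)); rewrite add0r -h.
  by rewrite -[c *: y]addr0 Mlin M0 addr0.
set y := q^-1 *: M x.
have Mp : M (x + y) = M x + M y by rewrite -{1}[x]scale1r Mlin scale1r.
have Mm : M (x - y) = M x - M y.
  by rewrite addrC -scaleN1r Mlin scaleN1r addrC.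
have := Mq (x - y); have := Mq (x + y).
rewrite Mp Mm !(ipDl, ipDr, ipNl, ipNr).
rewrite (ipC y x) (_ : ip (M y) x = ip (M x) y); last by rewrite Msa ipC.
rewrite !ler_norml => /andP[_ h1] /andP[h2 _].
have h : 2 * ip (M x) y <= q * ip x x + q * ip y y by lra.
move: h; rewrite /y !ipZl !ipZr => h.
have {h} : q^-1 * ip (M x) (M x) <= q * ip x x.
  have : q * (q^-1 * (q^-1 * ip (M x) (M x))) = q^-1 * ip (M x) (M x).
    by rewrite mulVKf ?gt_eqF.
  by lra.
by rewrite mulrC ler_pdivrMr// mulrC mulrA -expr2.
Qed.

(** * Richardson iteration on the squared operator *)

Section Iteration.
Variables (H : V -> V) (l h : F) (S : nat -> V -> Prop) (T : nat).
Hypotheses (l_gt0 : 0 < l) (l_lt_h : l < h).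
Hypothesis Hlin : forall c x y, H (c *: x + y) = c *: H x + H y.
Hypothesis Hsa : forall x y, ip (H x) y = ip x (H y).
Hypothesis Hlb : forall x, l ^+ 2 * ip x x <= ip (H x) (H x).
Hypothesis Hub : forall x, ip (H x) (H x) <= h ^+ 2 * ip x x.

(** The step size [c] balances the two ends of the spectrum of H^2: 1 - c l^2 = q and 1 - c h^2 =
    -q. *)
Let q := (h ^+ 2 - l ^+ 2) / (h ^+ 2 + l ^+ 2).
Let c := 2 / (h ^+ 2 + l ^+ 2).

Let dgt0 : 0 < h ^+ 2 + l ^+ 2.
Proof. by rewrite addr_gt0 ?exprn_gt0// (lt_trans l_gt0). Qed.

Let q_gt0 : 0 < q.
Proof.
rewrite divr_gt0// subr_gt0 ltr_pXn2r ?nnegrE ?ltW//.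
exact: lt_trans l_lt_h.
Qed.

Lemma richardson_contraction x :
  ip (x - c *: H (H x)) (x - c *: H (H x)) <= q ^+ 2 * ip x x.
Proof.
apply: (@selfadjoint_contraction (fun x => x - c *: H (H x))) => //.
- move=> k y z; rewrite !Hlin !scalerDr !scalerN !scalerA opprD addrACA.
  by rewrite (mulrC c k).
- by move=> y z; rewrite !(ipDl, ipDr, ipNl, ipNr, ipZl, ipZr) !Hsa.
move=> y; rewrite ipDl ipNl ipZl Hsa.
have c0 : 0 < c by rewrite divr_gt0.
have := Hlb y; rewrite -(ler_pM2l c0) => h1.
have := Hub y; rewrite -(ler_pM2l c0) => h2.
have e1 : q = 1 - c * l ^+ 2 by rewrite /q /c; field; rewrite gt_eqF.
have e2 : - q = 1 - c * h ^+ 2 by rewrite /q /c; field; rewrite gt_eqF.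
rewrite ler_norml -mulNr e2 e1; apply/andP; split; lra.
Qed.

Hypothesis S0 : forall k, S k 0.
Hypothesis Slin : forall k a x y, S k x -> S k y -> S k (a *: x + y).
Hypothesis Smono : forall k x, S k x -> S k.+1 x.
Hypothesis SH : forall k x, (k < T)%N -> S k x -> S k.+1 (H x).

(* The Richardson iteration w + c H (b - H w) for H^2 v = H b: starting from 0
   it leaves the data's neighbourhood by only two steps at a time. *)
Lemma local_approximation v : S 0%N (H v) -> forall k, (k.*2 <= T)%N ->
  exists2 w, S k.*2 w & snorm (v - w) <= q ^+ k * snorm v.
Proof.
move=> Sb; elim=> [|k IH] kT.
  by exists 0; [exact: S0|rewrite expr0 mul1r subr0].
rewrite doubleS in kT *.
have [|w Sw wle] := IH; first by rewrite ltnW// ltnW.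
exists (c *: H (H v - H w) + w).
  apply: Slin; last by apply: Smono; apply: Smono.
  apply: SH => //; rewrite -scaleN1r addrC.
  apply: Slin; first by apply: SH => //; exact: ltnW.
  by elim: (k.*2.+1) => // j; exact: Smono.
have -> : v - (c *: H (H v - H w) + w) = (v - w) - c *: H (H (v - w)).
  have -> : H (v - w) = H v - H w.
    by rewrite addrC -scaleN1r Hlin scaleN1r addrC.
  by rewrite opprD addrA addrAC.
rewrite exprS -mulrA.
apply: le_trans (_ : q * snorm (v - w) <= _); last first.
  by rewrite ler_wpM2l// ltW.
rewrite -(@ler_pXn2r _ 2%N) ?nnegrE ?snorm_ge0//; last first.
  by rewrite mulr_ge0 ?snorm_ge0// ltW.
by rewrite exprMn !sqr_snorm; exact: richardson_contraction.
Qed.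

End Iteration.
End SemiInnerProduct.

(** * Euclidean norm and stable linear systems *)

Section EuclideanNorm.
Context {F : realType}.

Definition dot n (x y : 'cV[F]_n) : F := (x^T *m y) 0 0.

Lemma dotE n (x y : 'cV[F]_n) : dot x y = \sum_i x i 0 * y i 0.
Proof. by rewrite /dot mxE; apply: eq_bigr => i _; rewrite mxE. Qed.

Lemma dotP n : semi_inner (@dot n).
Proof.
split=> [x y|c x y z|x].
- by rewrite !dotE; apply: eq_bigr => i _; rewrite mulrC.
- by rewrite /dot linearP mulmxDl -scalemxAl !mxE.
- by rewrite dotE sumr_ge0// => i _; rewrite -expr2 sqr_ge0.
Qed.
Local Hint Resolve dotP : core.

Lemma dot_mulmx m n (M : 'M[F]_(m, n)) x y :
  dot (M *m x) y = dot x (M^T *m y).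
Proof. by rewrite /dot trmx_mul mulmxA. Qed.

Lemma norm2E n (x : 'cV[F]_n) : norm2 x = snorm (@dot n) x.
Proof. by rewrite /norm2 /snorm dotE. Qed.

Lemma norm2_ge0 n (x : 'cV[F]_n) : 0 <= norm2 x.
Proof. exact: sqrtr_ge0. Qed.

Lemma sqr_norm2 n (x : 'cV[F]_n) : norm2 x ^+ 2 = dot x x.
Proof. by rewrite norm2E sqr_snorm. Qed.

Lemma norm2D n (x y : 'cV[F]_n) : norm2 (x + y) <= norm2 x + norm2 y.
Proof. by rewrite !norm2E snormD. Qed.

Lemma norm2B n (x y : 'cV[F]_n) : norm2 (x - y) <= norm2 x + norm2 y.
Proof. by rewrite !norm2E snormB. Qed.

Lemma norm2N n (x : 'cV[F]_n) : norm2 (- x) = norm2 x.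
Proof. by rewrite !norm2E snormN. Qed.

Lemma norm2Z n c (x : 'cV[F]_n) : norm2 (c *: x) = `|c| * norm2 x.
Proof. by rewrite !norm2E snormZ. Qed.

Lemma norm2_0 n : norm2 (0 : 'cV[F]_n) = 0.
Proof. by rewrite -(scale0r 0) norm2Z normr0 mul0r. Qed.

Lemma dot_le n (x y : 'cV[F]_n) : dot x y <= norm2 x * norm2 y.
Proof. by rewrite !norm2E ip_le. Qed.

Lemma norm2_eq0 n (x : 'cV[F]_n) : norm2 x = 0 -> x = 0.
Proof.
move=> x0; have : dot x x = 0 by rewrite -sqr_norm2 x0 expr0n.
rewrite dotE => /eqP; rewrite psumr_eq0 => [/allP xx|i _]; last first.
  by rewrite -expr2 sqr_ge0.
apply/matrixP => i j; rewrite ord1 mxE; apply/eqP.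
by have := xx i (mem_index_enum i); rewrite mulf_eq0 orbb.
Qed.

Lemma sqr_norm2D n (x y : 'cV[F]_n) :
  norm2 (x + y) ^+ 2 <= 2 * (norm2 x ^+ 2 + norm2 y ^+ 2).
Proof.
apply: le_trans (_ : (norm2 x + norm2 y) ^+ 2 <= _).
  by rewrite ler_pXn2r ?nnegrE ?addr_ge0 ?norm2_ge0 ?norm2D.
by have := sqr_ge0 (norm2 x - norm2 y); lra.
Qed.

Lemma sqr_norm2D3 k (x y z : 'cV[F]_k) :
  norm2 (x + y + z) ^+ 2 <= 3 * (norm2 x ^+ 2 + norm2 y ^+ 2 + norm2 z ^+ 2).
Proof.
apply: le_trans (_ : (norm2 x + norm2 y + norm2 z) ^+ 2 <= _).
  rewrite ler_pXn2r ?nnegrE ?addr_ge0 ?norm2_ge0//.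
  by apply: le_trans (norm2D _ _) _; rewrite lerD2r norm2D.
have := sqr_ge0 (norm2 x - norm2 y); have := sqr_ge0 (norm2 x - norm2 z).
by have := sqr_ge0 (norm2 y - norm2 z); lra.
Qed.

Lemma sqr_norm2D4 k (x y z w : 'cV[F]_k) : norm2 (x + y + z + w) ^+ 2 <=
  4 * (norm2 x ^+ 2 + norm2 y ^+ 2 + norm2 z ^+ 2 + norm2 w ^+ 2).
Proof.
rewrite -addrA; apply: le_trans (sqr_norm2D _ _) _.
by have := sqr_norm2D x y; have := sqr_norm2D z w; lra.
Qed.

Definition bounded_by m n (M : 'M[F]_(m, n)) (c : F) :=
  forall v, norm2 (M *m v) <= c * norm2 v.

(** The Frobenius norm serves as the constant. Its finiteness makes the set in [opnorm] bounded
    above, so that the supremum there is a genuine upper bound. *)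
Lemma bounded_by_exists m n (M : 'M[F]_(m, n)) :
  exists2 c, 0 <= c & bounded_by M c.
Proof.
exists (Num.sqrt (\sum_i norm2 (row i M)^T ^+ 2)); first exact: sqrtr_ge0.
move=> v; rewrite -(@ler_pXn2r _ 2%N) ?nnegrE ?norm2_ge0//; last first.
  by rewrite mulr_ge0 ?sqrtr_ge0 ?norm2_ge0.
rewrite exprMn [X in _ <= X * _]sqr_sqrtr; last first.
  by apply: sumr_ge0 => i _; exact: sqr_ge0.
rewrite (sqr_norm2 (M *m v)) dotE mulr_suml; apply: ler_sum => i _.
have -> : (M *m v) i 0 = dot (row i M)^T v.
  by rewrite dotE mxE; apply: eq_bigr => j _; rewrite !mxE.
by rewrite !sqr_norm2 -expr2 ip_CS.
Qed.

Lemma bounded_by_opnorm m n (M : 'M[F]_(m, n)) c :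
  opnorm M <= c -> bounded_by M c.
Proof.
move=> Mc v; have [C C0 MC] := bounded_by_exists M.
have [v0|v0] := eqVneq (norm2 v) 0.
  by have := MC v; rewrite v0 !mulr0.
have vgt0 : 0 < norm2 v by rewrite lt_neqAle eq_sym v0 norm2_ge0.
rewrite -ler_pdivrMr//; apply: le_trans Mc.
have -> : norm2 (M *m v) / norm2 v = norm2 (M *m ((norm2 v)^-1 *: v)).
  by rewrite -scalemxAr norm2Z ger0_norm ?invr_ge0 ?norm2_ge0// mulrC.
apply: ub_le_sup.
  exists C => _ [w /= w1 <-]; apply: le_trans (MC w) _.
  by rewrite -[leRHS]mulr1 ler_wpM2l.
exists ((norm2 v)^-1 *: v) => //=.
by rewrite norm2Z ger0_norm ?invr_ge0 ?norm2_ge0// mulVf.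
Qed.

Lemma bounded_by_le m n (M : 'M[F]_(m, n)) c d :
  c <= d -> bounded_by M c -> bounded_by M d.
Proof.
by move=> cd Mc v; apply: le_trans (Mc v) _; rewrite ler_wpM2r ?norm2_ge0.
Qed.

Lemma sqr_bounded_by k l (M : 'M[F]_(k, l)) c x : 0 <= c -> bounded_by M c ->
  norm2 (M *m x) ^+ 2 <= c ^+ 2 * norm2 x ^+ 2.
Proof.
move=> c0 Mc; rewrite -exprMn ler_pXn2r ?nnegrE ?mulr_ge0 ?norm2_ge0//.
Qed.

Lemma bounded_by_tr m n (M : 'M[F]_(m, n)) c :
  0 <= c -> bounded_by M c -> bounded_by M^T c.
Proof.
move=> c0 Mc v; have := norm2_ge0 (M^T *m v).
rewrite le_eqVlt => /predU1P[<-|w0]; first by rewrite mulr_ge0 ?norm2_ge0.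
rewrite -(ler_pM2l w0) -expr2 sqr_norm2 dot_mulmx trmxK.
apply: le_trans (dot_le _ _) _; have := Mc (M^T *m v).
move/(ler_wpM2l (norm2_ge0 v)) => h; apply: le_trans h _.
by apply: ler_of_eq; ring.
Qed.

Lemma bounded_by_mul m n p (M : 'M[F]_(m, n)) (M' : 'M[F]_(n, p)) c c' :
  0 <= c -> bounded_by M c -> bounded_by M' c' -> bounded_by (M *m M') (c * c').
Proof.
move=> c0 Mc Mc' v; rewrite -mulmxA -mulrA.
by apply: le_trans (Mc _) _; rewrite ler_wpM2l.
Qed.

Lemma psd_semi_inner n (M : 'M[F]_n) :
  psd M -> semi_inner (fun x y => dot x (M *m y)).
Proof.
move=> [Msym Mge0]; split=> [x y|c x y z|x].
- by rewrite -{1}Msym -dot_mulmx (ipC (dotP n)).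
- by rewrite (ipPl (dotP n)).
- by rewrite /dot mulmxA.
Qed.

Lemma psd_ge0 n (M : 'M[F]_n) x : psd M -> 0 <= dot x (M *m x).
Proof. by move=> /psd_semi_inner/ip_ge0; apply. Qed.

Lemma dot_psdC k (M : 'M[F]_k) x y : psd M -> dot (M *m x) y = dot (M *m y) x.
Proof.
move=> Mpsd; rewrite (ipC (dotP _)) (ipC (psd_semi_inner Mpsd)).
by rewrite (ipC (dotP _)).
Qed.

(** Cauchy-Schwarz in the form of [M], applied to My and y, gives |My|^4 <= <My, M(My)> <y, My>, and
    both factors are controlled by the quadratic form. *)
Lemma psd_bounded_by k (M : 'M[F]_k) c : 0 <= c -> psd M ->
  (forall y, dot y (M *m y) <= c * norm2 y ^+ 2) -> bounded_by M c.
Proof.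
move=> c0 Mpsd Mc y; have := ip_CS (psd_semi_inner Mpsd) (M *m y) y.
rewrite -sqr_norm2; set w := norm2 (M *m y) => h.
have := norm2_ge0 (M *m y); rewrite -/w le_eqVlt => /predU1P[<-|w0].
  by rewrite mulr_ge0 ?norm2_ge0.
have cy0 : 0 <= c * norm2 y by rewrite mulr_ge0 ?norm2_ge0.
rewrite -(@ler_pXn2r _ 2%N) ?nnegrE//; last exact: ltW.
rewrite -(@ler_pM2l _ (w ^+ 2)) ?exprn_gt0// -expr2; apply: le_trans h _.
apply: le_trans (ler_pM (psd_ge0 _ Mpsd) (psd_ge0 _ Mpsd) (Mc _) (Mc _)) _.
by apply: ler_of_eq; rewrite -/w; ring.
Qed.

(** The same Cauchy-Schwarz inequality, with only its first factor estimated. It bounds |Qx|, |Ru|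
    and |Px| by the energy, to which the KKT estimates have access. *)
Lemma psd_sqr_le n (M : 'M[F]_n) c x : psd M -> bounded_by M c ->
  norm2 (M *m x) ^+ 2 <= c * dot x (M *m x).
Proof.
move=> Mpsd Mc; have := ip_CS (psd_semi_inner Mpsd) (M *m x) x.
have [Msym _] := Mpsd; have x0 := psd_ge0 x Mpsd.
have Mx : dot (M *m x) (M *m (M *m x)) <= c * norm2 (M *m x) ^+ 2.
  apply: le_trans (dot_le _ _) _.
  by have := ler_wpM2l (norm2_ge0 (M *m x)) (Mc (M *m x)); lra.
rewrite -[dot (M *m x) (M *m x)]sqr_norm2.
set w := norm2 (M *m x) in Mx *; rewrite -exprM => h.
have := sqr_ge0 w; rewrite le_eqVlt => /predU1P[w0|w0].
  have [v0|v0] := eqVneq (norm2 x) 0.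
    by rewrite -w0 (norm2_eq0 v0) mulmx0 /dot mulmx0 mxE mulr0.
  rewrite -w0; apply: mulr_ge0 => //.
  have v1 : 0 < norm2 x by rewrite lt_neqAle eq_sym v0 norm2_ge0.
  rewrite -(pmulr_lge0 _ v1); exact: le_trans (norm2_ge0 _) (Mc x).
rewrite -(ler_pM2l w0); apply: le_trans (_ : w ^+ 4 <= _).
  by rewrite -exprD.
apply: le_trans h _; have := ler_wpM2r x0 Mx; lra.
Qed.

Lemma psd_dot_le n (M : 'M[F]_n) c x : bounded_by M c ->
  dot x (M *m x) <= c * norm2 x ^+ 2.
Proof.
move=> Mc; apply: le_trans (dot_le _ _) _.
by have := ler_wpM2l (norm2_ge0 x) (Mc x); lra.
Qed.

(* [z] solves the scalar comparison recursion z(t+1) = a z(t) + |w(t+1)|. *)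
Lemma stable_response n (Phi : 'M[F]_n) (L a : F) (y w : nat -> 'cV[F]_n) T :
  0 <= L -> 0 <= a < 1 ->
  (forall t, bounded_by (Phi ^+ t) (L * a ^+ t)) ->
  y 0%N = w 0%N ->
  (forall t, (t < T)%N -> y t.+1 = Phi *m y t + w t.+1) ->
  \sum_(t < T.+1) norm2 (y t) ^+ 2
    <= (L / (1 - a)) ^+ 2 * \sum_(t < T.+1) norm2 (w t) ^+ 2.
Proof.
move=> L0 /andP[a0 a1] Phib y0 yS.
pose z := fix z t := if t is s.+1 then a * z s + norm2 (w s.+1)
                     else norm2 (w 0%N).
have z_ge0 t : 0 <= z t.
  by elim: t => [|t IH] /=; rewrite ?addr_ge0 ?mulr_ge0 ?norm2_ge0.
(* The induction carries a further power [Phi ^+ k], so that the constant [L] is paid once and not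
   at every time step. *)
have yz t k : (t <= T)%N ->
    norm2 (Phi ^+ k *m y t) <= L * a ^+ k * z t.
  elim: t k => [|t IH] k tT /=; first by rewrite y0; exact: Phib.
  rewrite yS// mulmxDr mulmxA mulmxE -exprSr.
  apply: le_trans (norm2D _ _) _.
  have h1 := IH k.+1 (ltnW tT); have h2 := Phib k (w t.+1).
  rewrite (exprSr a) in h1; lra.
(* By convexity (a z + r)^2 <= a z^2 + r^2 / (1 - a); the extra summand [a * z T ^+ 2] makes the
   induction telescope. *)
have zsum : (1 - a) * \sum_(t < T.+1) z t ^+ 2 + a * z T ^+ 2
    <= (1 - a)^-1 * \sum_(t < T.+1) norm2 (w t) ^+ 2.
  have b0 : 0 < 1 - a by rewrite subr_gt0.
  have b1 : (1 - a) * (1 - a)^-1 = 1 by rewrite mulfV// gt_eqF.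
  have b2 : 1 <= (1 - a)^-1 by rewrite invf_ge1//; lra.
  elim: (T) => [|s IH].
    rewrite !big_ord1 /= -mulrDl subrK mul1r ler_peMl ?sqr_ge0//.
  rewrite big_ord_recr [X in _ <= _ * X]big_ord_recr /= mulrDr [leRHS]mulrDr.
  have : (a * z s + norm2 (w s.+1)) ^+ 2
      <= a * z s ^+ 2 + (1 - a)^-1 * norm2 (w s.+1) ^+ 2.
    rewrite -subr_ge0 -(pmulr_rge0 _ b0).
    set r := norm2 _; set zs := z s.
    have -> : (1 - a) * (a * zs ^+ 2 + (1 - a)^-1 * r ^+ 2 - (a * zs + r) ^+ 2)
      = a * ((1 - a) * zs - r) ^+ 2 by field; rewrite gt_eqF.
    by rewrite mulr_ge0 ?sqr_ge0.
  lra.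
have b0 : 0 < 1 - a by rewrite subr_gt0.
have {}zsum : \sum_(t < T.+1) z t ^+ 2
    <= (1 - a)^-1 ^+ 2 * \sum_(t < T.+1) norm2 (w t) ^+ 2.
  rewrite -(ler_pM2l b0).
  have -> : (1 - a) * ((1 - a)^-1 ^+ 2 * \sum_(t < T.+1) norm2 (w t) ^+ 2)
    = (1 - a)^-1 * \sum_(t < T.+1) norm2 (w t) ^+ 2 by field; rewrite gt_eqF.
  apply: le_trans zsum; rewrite lerDl mulr_ge0// sqr_ge0//.
apply: le_trans (_ : \sum_(t < T.+1) L ^+ 2 * z t ^+ 2 <= _).
  apply: ler_sum => t _; rewrite -exprMn ler_pXn2r ?nnegrE ?norm2_ge0//.
    by have := yz t 0%N (ltn_ord t); rewrite !expr0 mulr1 mul1mx.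
  by rewrite mulr_ge0.
rewrite -mulr_sumr exprMn -[leRHS]mulrA.
by rewrite ler_wpM2l ?sqr_ge0.
Qed.

End EuclideanNorm.
#[global] Hint Resolve dotP : core.

(** * The KKT system of the finite-horizon problem *)

Section KKT.
Context {F : realType} {n m : nat}.
Variables (A : 'M[F]_n) (B : 'M[F]_(n, m)) (Q : 'M[F]_n) (R : 'M[F]_m).
Variables (P : 'M[F]_n) (T : nat).

(* States, controls and multipliers of the horizon-T problem; the entries
   beyond the horizon are ignored by [tip]. *)
Definition traj : Type :=
  ((nat -> 'cV[F]_n) * (nat -> 'cV[F]_m) * (nat -> 'cV[F]_n))%type.

HB.instance Definition _ := GRing.Lmodule.on traj.

Definition tip (v w : traj) : F :=
  \sum_(t < T.+1) dot (v.1.1 t) (w.1.1 t) + \sum_(t < T) dot (v.1.2 t) (w.1.2 t)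
  + \sum_(t < T.+1) dot (v.2 t) (w.2 t).

Definition kkt (v : traj) : traj :=
  (fun t => (if (t < T)%N then Q *m v.1.1 t - A^T *m v.2 t.+1
             else P *m v.1.1 t) + v.2 t,
   fun t => R *m v.1.2 t - B^T *m v.2 t.+1,
   fun t => v.1.1 t - (if t is s.+1 then A *m v.1.1 s + B *m v.1.2 s else 0)).

Definition flip (v : traj) : traj := (v.1.1, v.1.2, fun t => - v.2 t).

Lemma tipP : semi_inner tip.
Proof.
split=> [v w|c v w z|v].
- by congr (_ + _ + _); apply: eq_bigr => t _; rewrite (ipC (dotP _)).
- rewrite /tip !mulrDr !mulr_sumr !addrA.
  rewrite [LHS](_ : _ = \sum_(t < T.+1)
      (c * dot (v.1.1 t) (z.1.1 t) + dot (w.1.1 t) (z.1.1 t)) +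
    \sum_(t < T) (c * dot (v.1.2 t) (z.1.2 t) + dot (w.1.2 t) (z.1.2 t)) +
    \sum_(t < T.+1) (c * dot (v.2 t) (z.2 t) + dot (w.2 t) (z.2 t))).
    by rewrite !big_split /=; ring.
  by congr (_ + _ + _); apply: eq_bigr => t _; rewrite -(ipPl (dotP _)).
- by rewrite !addr_ge0// sumr_ge0// => t _; exact: ip_ge0.
Qed.
Local Hint Resolve tipP : core.

Lemma kkt_linear c v w : kkt (c *: v + w) = c *: kkt v + kkt w.
Proof.
have hD k (x x' y y' : 'cV[F]_k) :
    (c *: x + x') + (c *: y + y') = c *: (x + y) + (x' + y').
  by rewrite scalerDr addrACA.
have hB k (x x' y y' : 'cV[F]_k) :
    (c *: x + x') - (c *: y + y') = c *: (x - y) + (x' - y').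
  by rewrite scalerDr scalerN opprD addrACA.
have fE k (f f' : nat -> 'cV[F]_k) t : (c *: f + f') t = c *: f t + f' t by [].
congr (_, _, _); apply/funext => t; rewrite /= !fE.
- by case: ifP => _; rewrite !mulmxDr -!scalemxAr ?hB hD.
- by rewrite !mulmxDr -!scalemxAr hB.
- case: t => [|t]; first by rewrite !subr0.
  by rewrite !fE !mulmxDr -!scalemxAr hD hB.
Qed.

Hypotheses (Qpsd : psd Q) (Rpsd : psd R) (Ppsd : psd P).

(** Moving [A] and [B] across the product groups the pairing into sums that are each symmetric in
    [v] and [w], which yields self-adjointness sum by sum. For [w = flip v] the two sums with
    multipliers cancel and the energy remains. *)
Lemma tip_kktE v w : tip (kkt v) w =
  \sum_(t < T) (dot (Q *m v.1.1 t) (w.1.1 t) + dot (R *m v.1.2 t) (w.1.2 t))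
  + dot (P *m v.1.1 T) (w.1.1 T)
  + \sum_(t < T.+1) (dot (v.2 t) (w.1.1 t) + dot (v.1.1 t) (w.2 t))
  - \sum_(t < T) (dot (v.2 t.+1) (A *m w.1.1 t + B *m w.1.2 t)
                  + dot (A *m v.1.1 t + B *m v.1.2 t) (w.2 t.+1)).
Proof.
rewrite /tip /=.
have -> : \sum_(t < T.+1) dot ((if (t < T)%N then Q *m v.1.1 t - A^T *m v.2 t.+1
      else P *m v.1.1 t) + v.2 t) (w.1.1 t)
    = \sum_(t < T) (dot (Q *m v.1.1 t) (w.1.1 t)
                    - dot (v.2 t.+1) (A *m w.1.1 t))
      + dot (P *m v.1.1 T) (w.1.1 T) + \sum_(t < T.+1) dot (v.2 t) (w.1.1 t).
  under eq_bigr do rewrite (ipDl (dotP _)).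
  rewrite big_split /=; congr (_ + _).
  rewrite big_ord_recr /= ltnn; congr (_ + _); apply: eq_bigr => t _.
  by rewrite ltn_ord (ipDl (dotP _)) (ipNl (dotP _)) [dot (A^T *m _) _]dot_mulmx trmxK.
have -> : \sum_(t < T) dot (R *m v.1.2 t - B^T *m v.2 t.+1) (w.1.2 t)
    = \sum_(t < T) (dot (R *m v.1.2 t) (w.1.2 t)
                    - dot (v.2 t.+1) (B *m w.1.2 t)).
  apply: eq_bigr => t _.
  by rewrite (ipDl (dotP _)) (ipNl (dotP _)) [dot (B^T *m _) _]dot_mulmx trmxK.
have -> : \sum_(t < T.+1) dot (v.1.1 t - (if (t : nat) is s.+1
      then A *m v.1.1 s + B *m v.1.2 s else 0)) (w.2 t)
    = \sum_(t < T.+1) dot (v.1.1 t) (w.2 t)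
      - \sum_(t < T) dot (A *m v.1.1 t + B *m v.1.2 t) (w.2 t.+1).
  under eq_bigr do rewrite (ipDl (dotP _)) (ipNl (dotP _)).
  rewrite big_split /= sumrN; congr (_ - _).
  by rewrite big_ord_recl /= (ip0l (dotP _)) add0r.
have -> : \sum_(t < T) (dot (v.2 t.+1) (A *m w.1.1 t + B *m w.1.2 t)
      + dot (A *m v.1.1 t + B *m v.1.2 t) (w.2 t.+1))
    = \sum_(t < T) dot (v.2 t.+1) (A *m w.1.1 t)
      + \sum_(t < T) dot (v.2 t.+1) (B *m w.1.2 t)
      + \sum_(t < T) dot (A *m v.1.1 t + B *m v.1.2 t) (w.2 t.+1).
  by rewrite -!big_split /=; apply: eq_bigr => t _; rewrite (ipDr (dotP _)).
rewrite !big_split /= !sumrN; ring.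
Qed.

Lemma kkt_selfadjoint v w : tip (kkt v) w = tip v (kkt w).
Proof.
rewrite (ipC tipP v) !tip_kktE; congr (_ + _ + _ - _).
- by apply: eq_bigr => t _; rewrite !(dot_psdC (v.1.1 _)) ?(dot_psdC (v.1.2 _)).
- by rewrite dot_psdC.
- apply: eq_bigr => t _.
  by rewrite addrC (ipC (dotP _)) [X in _ + X](ipC (dotP _)).
- apply: eq_bigr => t _.
  by rewrite addrC (ipC (dotP _)) [X in _ + X](ipC (dotP _)).
Qed.

Definition energy (v : traj) : F :=
  \sum_(t < T) (dot (v.1.1 t) (Q *m v.1.1 t) + dot (v.1.2 t) (R *m v.1.2 t))
  + dot (v.1.1 T) (P *m v.1.1 T).

Lemma tip_kkt_flip v : tip (kkt v) (flip v) = energy v.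
Proof.
rewrite tip_kktE /= -[RHS]addr0 -addrA; congr (_ + _); first congr (_ + _).
- by apply: eq_bigr => t _; rewrite (ipC (dotP _)) [X in _ + X](ipC (dotP _)).
- by rewrite (ipC (dotP _)).
rewrite !big1 ?subrr// => t _; rewrite (ipNr (dotP _)) (ipC (dotP _)) ?subrr//.
Qed.

Lemma tip_flip v : tip (flip v) (flip v) = tip v v.
Proof.
congr (_ + _); apply: eq_bigr => t _ /=.
by rewrite (ipNl (dotP _)) (ipNr (dotP _)) opprK.
Qed.

Lemma energy_le v : energy v <= snorm tip (kkt v) * snorm tip v.
Proof.
rewrite -tip_kkt_flip; apply: le_trans (ip_le tipP _ _) _.
by rewrite {2}/snorm tip_flip.
Qed.

Lemma tip_norm2E v : tip v v = \sum_(t < T.+1) norm2 (v.1.1 t) ^+ 2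
  + \sum_(t < T) norm2 (v.1.2 t) ^+ 2 + \sum_(t < T.+1) norm2 (v.2 t) ^+ 2.
Proof. by congr (_ + _ + _); apply: eq_bigr => t _; rewrite sqr_norm2. Qed.

(** Each row of the KKT operator has at most three terms, each given by a matrix of norm at most
    [c], and each entry of [v] enters at most three rows: hence the factor 3 * 3 = 3^2. *)
Lemma kkt_upper_bound c v : 1 <= c -> bounded_by A c -> bounded_by B c ->
  bounded_by Q c -> bounded_by R c -> bounded_by P c ->
  tip (kkt v) (kkt v) <= (3 * c) ^+ 2 * tip v v.
Proof.
move=> c1 Ac Bc Qc Rc Pc; rewrite !tip_norm2E /=.
have c0 : 0 <= c by lra.
have s1 : 1 <= c ^+ 2 by rewrite exprn_ege1.
have Atc := bounded_by_tr c0 Ac; have Btc := bounded_by_tr c0 Bc.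
have idc k (x : 'cV[F]_k) : norm2 x ^+ 2 <= c ^+ 2 * norm2 x ^+ 2.
  by rewrite ler_peMl ?sqr_ge0.
rewrite exprMn.
set s := c ^+ 2 in s1 idc *.
set x := v.1.1; set u := v.1.2; set l := v.2.
have sb k j (M : 'M[F]_(k, j)) y : bounded_by M c ->
    norm2 (M *m y) ^+ 2 <= s * norm2 y ^+ 2 by exact: sqr_bounded_by.
have hX (t : 'I_T) : norm2 (Q *m x t - A^T *m l t.+1 + l t) ^+ 2
    <= 3 * s * (norm2 (x t) ^+ 2 + norm2 (l t.+1) ^+ 2 + norm2 (l t) ^+ 2).
  apply: le_trans (sqr_norm2D3 _ _ _) _; rewrite norm2N.
  have := sb _ _ _ (x t) Qc; have := sb _ _ _ (l t.+1) Atc.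
  by have := idc _ (l t); lra.
have hP : norm2 (P *m x T + l T) ^+ 2
    <= 2 * s * (norm2 (x T) ^+ 2 + norm2 (l T) ^+ 2).
  apply: le_trans (sqr_norm2D _ _) _.
  by have := sb _ _ _ (x T) Pc; have := idc _ (l T); lra.
have hU (t : 'I_T) : norm2 (R *m u t - B^T *m l t.+1) ^+ 2
    <= 2 * s * (norm2 (u t) ^+ 2 + norm2 (l t.+1) ^+ 2).
  apply: le_trans (sqr_norm2D _ _) _; rewrite norm2N.
  by have := sb _ _ _ (u t) Rc; have := sb _ _ _ (l t.+1) Btc; lra.
have hL (t : 'I_T) : norm2 (x t.+1 - (A *m x t + B *m u t)) ^+ 2
    <= 3 * s * (norm2 (x t.+1) ^+ 2 + norm2 (x t) ^+ 2 + norm2 (u t) ^+ 2).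
  rewrite opprD addrA; apply: le_trans (sqr_norm2D3 _ _ _) _; rewrite !norm2N.
  have := sb _ _ _ (x t) Ac; have := sb _ _ _ (u t) Bc.
  by have := idc _ (x t.+1); lra.
rewrite big_ord_recr /= ltnn.
rewrite [X in _ + X <= _]big_ord_recl /= subr0.
under eq_bigr do rewrite ltn_ord.
have sX := @ler_sum _ _ (index_enum 'I_T) predT _ _ (fun t _ => hX t).
have sU := @ler_sum _ _ (index_enum 'I_T) predT _ _ (fun t _ => hU t).
have sL := @ler_sum _ _ (index_enum 'I_T) predT _ _ (fun t _ => hL t).
move: sX sU sL; rewrite -!mulr_sumr !big_split /= => sX sU sL.
have eX : \sum_(t < T.+1) norm2 (x t) ^+ 2
  = \sum_(t < T) norm2 (x t) ^+ 2 + norm2 (x T) ^+ 2 by rewrite big_ord_recr.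
have eX' : \sum_(t < T.+1) norm2 (x t) ^+ 2
  = norm2 (x 0%N) ^+ 2 + \sum_(t < T) norm2 (x t.+1) ^+ 2
  by rewrite big_ord_recl.
have eL : \sum_(t < T.+1) norm2 (l t) ^+ 2
  = \sum_(t < T) norm2 (l t) ^+ 2 + norm2 (l T) ^+ 2 by rewrite big_ord_recr.
have eL' : \sum_(t < T.+1) norm2 (l t) ^+ 2
  = norm2 (l 0%N) ^+ 2 + \sum_(t < T) norm2 (l t.+1) ^+ 2
  by rewrite big_ord_recl.
have ix0 := idc _ (x 0%N).
rewrite -/x -/u -/l in sX sU sL *.
move: hP eX eX' eL eL' sX sU sL ix0.
set X := \sum_(t < T.+1) norm2 (x t) ^+ 2.
set X0 := \sum_(t < T) norm2 (x t) ^+ 2.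
set X1 := \sum_(t < T) norm2 (x t.+1) ^+ 2.
set U := \sum_(t < T) norm2 (u t) ^+ 2.
set L := \sum_(t < T.+1) norm2 (l t) ^+ 2.
set L0 := \sum_(t < T) norm2 (l t) ^+ 2.
set L1 := \sum_(t < T) norm2 (l t.+1) ^+ 2.
move=> hP eX eX' eL eL' sX sU sL ix0.
have [U_ge0 X0_ge0 X1_ge0 L0_ge0 L1_ge0] :
    [/\ 0 <= U, 0 <= X0, 0 <= X1, 0 <= L0 & 0 <= L1].
  by split; apply: sumr_ge0 => t _; exact: sqr_ge0.
have q k (y : 'cV[F]_k) := sqr_ge0 (norm2 y).
have sp y : 0 <= y -> 0 <= s * y by move=> ?; rewrite mulr_ge0// (le_trans ler01).
have := sp _ U_ge0; have := sp _ X0_ge0; have := sp _ X1_ge0.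
have := sp _ L0_ge0; have := sp _ L1_ge0; have := sp _ (q _ (x 0%N)).
have := sp _ (q _ (x T)); have := sp _ (q _ (l 0%N)); have := sp _ (q _ (l T)).
have e1 : s * X = s * X0 + s * norm2 (x T) ^+ 2 by rewrite eX mulrDr.
have e2 : s * X = s * norm2 (x 0%N) ^+ 2 + s * X1 by rewrite eX' mulrDr.
have e3 : s * L = s * L0 + s * norm2 (l T) ^+ 2 by rewrite eL mulrDr.
have e4 : s * L = s * norm2 (l 0%N) ^+ 2 + s * L1 by rewrite eL' mulrDr.
lra.
Qed.

(** * Coercivity of the KKT operator, uniform in the horizon *)

Section LowerBound.
Variables (L a g Lp : F) (C : 'M[F]_n) (Kb : 'M[F]_(m, n)) (Kd : 'M[F]_n).
Hypotheses (L_ge1 : 1 <= L) (a_bnd : 0 <= a < 1) (g_bnd : 0 < g <= 1).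
Hypothesis Lp_ge : L ^+ 3 <= Lp.
Hypotheses (BL : bounded_by B L) (QL : bounded_by Q L) (RL : bounded_by R L).
Hypothesis PLp : bounded_by P Lp.
Hypothesis Rg : forall u, g * norm2 u ^+ 2 <= dot u (R *m u).
Hypothesis QC : forall x, dot x (Q *m x) = norm2 (C *m x) ^+ 2.
Hypotheses (KbL : bounded_by Kb L) (KdL : bounded_by Kd L).
Hypothesis Kb_stable : forall t, bounded_by ((A - B *m Kb) ^+ t) (L * a ^+ t).
Hypothesis Kd_stable :
  forall t, bounded_by ((A^T - C^T *m Kd) ^+ t) (L * a ^+ t).

Let c2 := (L / (1 - a)) ^+ 2.

Let L_ge0 : 0 <= L. Proof. exact: le_trans ler01 L_ge1. Qed.

Let L2_ge1 : 1 <= L ^+ 2. Proof. by rewrite exprn_ege1. Qed.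

Let L2Lp : L ^+ 2 <= Lp.
Proof. by apply: le_trans Lp_ge; rewrite (exprSr L 2) ler_peMr ?sqr_ge0. Qed.

Let LLp : L <= Lp.
Proof. by apply: le_trans L2Lp; rewrite expr2 ler_peMr. Qed.

Let Lp_ge1 : 1 <= Lp. Proof. exact: le_trans L_ge1 LLp. Qed.

Let c2_ge1 : 1 <= c2.
Proof.
have [a0 a1] := andP a_bnd.
rewrite exprn_ege1// ler_pdivlMr ?mul1r ?subr_gt0//.
by apply: le_trans L_ge1; rewrite gerBl.
Qed.

(** Both estimates below run on transposes: detectability concerns [A^T] while the states evolve
    under [A - Kd^T *m C], and the multipliers evolve under [(A - B *m Kb)^T]. *)
Lemma stable_tr k (M : 'M[F]_k) :
  (forall t, bounded_by (M ^+ t) (L * a ^+ t)) ->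
  forall t, bounded_by (M^T ^+ t) (L * a ^+ t).
Proof.
have [a0 _] := andP a_bnd => Ms t.
have -> : M^T ^+ t = (M ^+ t)^T.
  elim: t => [|t IH]; first by rewrite !expr0 trmx1.
  by rewrite exprSr IH exprS -[RHS]/((M *m M ^+ t)^T) trmx_mul.
by apply: bounded_by_tr => //; rewrite mulr_ge0 ?exprn_ge0.
Qed.

Section Estimates.
Variable v : traj.

Let x := v.1.1.
Let u := v.1.2.
Let l := v.2.
Let f := (kkt v).1.1.
Let h := (kkt v).1.2.
Let d := (kkt v).2.
Let eQ := \sum_(t < T) dot (x t) (Q *m x t).
Let eR := \sum_(t < T) dot (u t) (R *m u t).
Let eP := dot (x T) (P *m x T).

Let eQ_ge0 : 0 <= eQ. Proof. by apply: sumr_ge0 => t _; exact: psd_ge0. Qed.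
Let eR_ge0 : 0 <= eR. Proof. by apply: sumr_ge0 => t _; exact: psd_ge0. Qed.
Let eP_ge0 : 0 <= eP. Proof. exact: psd_ge0. Qed.

Let control_energy : g * \sum_(t < T) norm2 (u t) ^+ 2 <= eR.
Proof. by rewrite mulr_sumr; apply: ler_sum => t _; exact: Rg. Qed.

(* Detectability: x(t+1) = (A - Kd^T C) x(t) + (Kd^T C x(t) + B u(t) + d(t+1)). *)
Let state_estimate : \sum_(t < T.+1) norm2 (x t) ^+ 2 <= c2 *
  (3 * (L ^+ 2 * eQ + L ^+ 2 * \sum_(t < T) norm2 (u t) ^+ 2
        + \sum_(t < T.+1) norm2 (d t) ^+ 2)).
Proof.
pose w t := if t is s.+1 then Kd^T *m (C *m x s) + B *m u s + d t else d 0%N.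
apply: le_trans (@stable_response _ _ (A - Kd^T *m C) L a x w T L_ge0 a_bnd _ _ _) _.
- move=> t; have := stable_tr Kd_stable t.
  by rewrite linearB /= trmx_mul !trmxK.
- by rewrite /w /d /= subr0.
- move=> t _; rewrite /w /d /= mulmxBl -mulmxA -/x -/u.
  move: (A *m x t) (B *m u t) (Kd^T *m _) => y1 y2 y3.
  by apply/matrixP => i j; rewrite !mxE; ring.
rewrite ler_wpM2l ?sqr_ge0// big_ord_recl /=.
have hw (t : 'I_T) : norm2 (Kd^T *m (C *m x t) + B *m u t + d t.+1) ^+ 2 <=
    3 * (L ^+ 2 * dot (x t) (Q *m x t) + L ^+ 2 * norm2 (u t) ^+ 2
         + norm2 (d t.+1) ^+ 2).
  apply: le_trans (sqr_norm2D3 _ _ _) _; rewrite ler_pM2l// lerD2r QC lerD//.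
    by apply: sqr_bounded_by => //; exact: bounded_by_tr.
  exact: sqr_bounded_by.
have := @ler_sum _ _ (index_enum 'I_T) predT _ _ (fun t _ => hw t).
rewrite -!mulr_sumr !big_split /= -!mulr_sumr -/eQ => sw.
have -> : \sum_(t < T.+1) norm2 (d t) ^+ 2
  = norm2 (d 0%N) ^+ 2 + \sum_(t < T) norm2 (d t.+1) ^+ 2 by rewrite big_ord_recl.
by have := sqr_ge0 (norm2 (d 0%N)); lra.
Qed.

(* Stabilizability, backwards in time:
   l(t) = (A - B Kb)^T l(t+1) + (Kb^T (R u(t) - h(t)) - Q x(t) + f(t)). *)
Let multiplier_estimate : \sum_(t < T.+1) norm2 (l t) ^+ 2 <= c2 *
  (4 * (L ^+ 3 * eR + L * eQ + Lp * eP
        + L ^+ 2 * \sum_(t < T) norm2 (h t) ^+ 2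
        + \sum_(t < T.+1) norm2 (f t) ^+ 2)).
Proof.
pose r t := Kb^T *m (R *m u t) + - (Kb^T *m h t) + - (Q *m x t) + f t.
(* In reversed time s = T - t the recursion starts from the terminal row l(T) = f(T) - P x(T), whose
   second term is paid for by [eP]. *)
pose w s := if s is s'.+1 then r (T - s)%N else f T - P *m x T.
have -> : \sum_(t < T.+1) norm2 (l t) ^+ 2
    = \sum_(t < T.+1) norm2 (l (T - t)%N) ^+ 2.
  rewrite (reindex_inj rev_ord_inj) /=.
  by apply: eq_bigr => t _; rewrite subSS.
apply: le_trans (@stable_response _ _ (A - B *m Kb)^T L a
  (fun s => l (T - s)%N) w T L_ge0 a_bnd _ _ _) _.
- exact: stable_tr.
- rewrite /w /f /= subn0 ltnn -/x -/l.
  by rewrite addrAC subrr add0r.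
- move=> s sT; rewrite /w /r /f /h /= ltn_subrL ltn0Sn (leq_ltn_trans _ sT)//=.
  rewrite -/x -/u -/l subnSK// linearB /= trmx_mul mulmxBl mulmxBr -mulmxA.
  move: (A^T *m _) (Kb^T *m (R *m _)) (Kb^T *m (B^T *m _)) (Q *m _) => y1 y2 y3 y4.
  by apply/matrixP => i j; rewrite !mxE; ring.
rewrite ler_wpM2l ?sqr_ge0// big_ord_recl /=.
have hw (t : 'I_T) : norm2 (r t) ^+ 2 <=
    4 * (L ^+ 3 * dot (u t) (R *m u t) + L ^+ 2 * norm2 (h t) ^+ 2
         + L * dot (x t) (Q *m x t) + norm2 (f t) ^+ 2).
  apply: le_trans (sqr_norm2D4 _ _ _ _) _; rewrite ler_pM2l// lerD2r !norm2N.
  have KbtL := bounded_by_tr L_ge0 KbL.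
  rewrite lerD//; last exact: psd_sqr_le.
  rewrite lerD//; last exact: sqr_bounded_by.
  apply: le_trans (sqr_bounded_by _ L_ge0 KbtL) _.
  by rewrite (exprSr L 2) -mulrA ler_wpM2l ?sqr_ge0//; exact: psd_sqr_le.
have -> : \sum_(i < T) norm2 (r (T - bump 0 i)%N) ^+ 2
    = \sum_(t < T) norm2 (r t) ^+ 2.
  by rewrite [RHS](reindex_inj rev_ord_inj).
have := @ler_sum _ _ (index_enum 'I_T) predT _ _ (fun t _ => hw t).
rewrite -!mulr_sumr !big_split /= -!mulr_sumr -/eQ -/eR => sw.
have -> : \sum_(t < T.+1) norm2 (f t) ^+ 2
  = \sum_(t < T) norm2 (f t) ^+ 2 + norm2 (f T) ^+ 2 by rewrite big_ord_recr.
have := sqr_norm2D (f T) (- (P *m x T)); rewrite norm2N.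
have := psd_sqr_le (x T) Ppsd PLp; rewrite -/eP => hP.
have := mulr_ge0 (le_trans ler01 Lp_ge1) eP_ge0.
by have := sqr_ge0 (norm2 (f T)); lra.
Qed.

(** Multiplying by [g] first turns the control term of the state estimate into [eR]. The factor 8 =
    3 + 4 + 1 adds up the weights of [eR] in the bounds for state, multiplier and control. *)
Lemma kkt_lower_bound_energy :
  g * tip v v <= 8 * c2 * Lp * (energy v + tip (kkt v) (kkt v)).
Proof.
have [g0 g1] := andP g_bnd; have c2_ge0 : 0 <= c2 by exact: le_trans c2_ge1.
rewrite tip_norm2E -/x -/u -/l.
have -> : energy v = eQ + eR + eP by rewrite /energy big_split.
rewrite (tip_norm2E (kkt v)) -/f -/h -/d.
have := state_estimate; have := multiplier_estimate; have := control_energy.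
set X := \sum_(t < T.+1) norm2 (x t) ^+ 2.
set U := \sum_(t < T) norm2 (u t) ^+ 2.
set l2 := \sum_(t < T.+1) norm2 (l t) ^+ 2.
set f2 := \sum_(t < T.+1) norm2 (f t) ^+ 2.
set h2 := \sum_(t < T) norm2 (h t) ^+ 2.
set d2 := \sum_(t < T.+1) norm2 (d t) ^+ 2.
move=> hU hl hX.
have [f20 h20 d20 U0] : [/\ 0 <= f2, 0 <= h2, 0 <= d2 & 0 <= U].
  by split; apply: sumr_ge0 => t _; exact: sqr_ge0.
have [X0 l20] : 0 <= X /\ 0 <= l2.
  by split; apply: sumr_ge0 => t _; exact: sqr_ge0.
have m1 y k : 0 <= y -> k <= Lp -> k * y <= Lp * y.
  by move=> y0 kL; exact: ler_wpM2r.
have m2 y : 0 <= y -> g * y <= y by move=> y0; rewrite ler_piMl.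
have gX : g * X <= c2 * (3 * Lp * (eQ + eR + d2)).
  apply: le_trans (ler_wpM2l (ltW g0) hX) _; rewrite mulrCA ler_wpM2l//.
  have e1 : g * (L ^+ 2 * eQ) <= Lp * eQ.
    by apply: le_trans (m2 _ _) (m1 _ _ _ _); rewrite ?mulr_ge0 ?sqr_ge0.
  have e2 : L ^+ 2 * (g * U) <= Lp * eR.
    by apply: le_trans (m1 _ _ eR_ge0 L2Lp); rewrite ler_wpM2l ?sqr_ge0.
  have e3 : g * d2 <= Lp * d2 by rewrite m1// (le_trans g1).
  lra.
have gl : g * l2 <= c2 * (4 * Lp * (eQ + eR + eP + h2 + f2)).
  apply: le_trans (m2 _ l20) _; apply: le_trans hl _; rewrite ler_wpM2l//.
  have := m1 _ _ eR_ge0 Lp_ge; have := m1 _ _ eQ_ge0 LLp.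
  by have := m1 _ _ h20 L2Lp; have := m1 _ _ f20 Lp_ge1; lra.
have gU : g * U <= c2 * (Lp * eR).
  apply: le_trans hU _; rewrite mulrA ler_peMl//.
  by apply: mulr_ege1.
have p y : 0 <= y -> 0 <= c2 * (Lp * y).
  by move=> y0; apply: mulr_ge0 => //; exact: mulr_ge0 (le_trans ler01 Lp_ge1) y0.
have := p _ eQ_ge0; have := p _ eR_ge0; have := p _ eP_ge0.
have := p _ f20; have := p _ h20; have := p _ d20; lra.
Qed.

(** As the energy is at most |Hv| |v|, the previous bound reads V^2 <= j (b V + b^2) with V = |v|, b
    = |Hv| and j >= 1, and this quadratic inequality forces V <= 2 j b. *)
Lemma kkt_lower_bound :
  snorm tip v <= 16 * c2 * Lp / g * snorm tip (kkt v).
Proof.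
have [g0 g1] := andP g_bnd.
have := kkt_lower_bound_energy.
set k := 8 * c2 * Lp => hk.
have k1 : 1 <= k / g.
  have : 1 <= c2 * Lp by apply: mulr_ege1.
  by rewrite ler_pdivlMr// /k; lra.
have -> : 16 * c2 * Lp / g = 2 * (k / g) by rewrite /k; ring.
have := energy_le v; move: hk; rewrite -!(sqr_snorm tipP).
have := snorm_ge0 tip v; have := snorm_ge0 tip (kkt v).
set V := snorm tip v; set b := snorm tip (kkt v); set j := k / g in k1 *.
move=> b0 V0 hk hE.
have {hk hE} : V ^+ 2 <= j * (b * V + b ^+ 2).
  rewrite /j mulrAC ler_pdivlMr// mulrC; apply: le_trans hk _.
  rewrite ler_wpM2l ?lerD2r//.
  by apply: mulr_ge0 (le_trans ler01 Lp_ge1); rewrite mulr_ge0 ?sqr_ge0.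
move=> hV; rewrite leNgt; apply/negP => Vb.
have bV : b <= V.
  apply: le_trans (ltW Vb); rewrite ler_peMl//; lra.
have : V ^+ 2 <= 2 * j * b * V.
  apply: le_trans hV _.
  have : j * (b * b) <= j * (b * V) by rewrite !ler_wpM2l//; lra.
  by rewrite expr2; lra.
have Vpos : 0 < V by apply: le_lt_trans Vb; rewrite mulr_ge0//; lra.
by rewrite expr2 ler_pM2r// leNgt Vb.
Qed.

End Estimates.
End LowerBound.
End KKT.

(** * Spatial and temporal decay of the optimal trajectory *)

Section RiccatiGain.
Context {F : realType} {n m : nat}.
Variables (A : 'M[F]_n) (B : 'M[F]_(n, m)) (Q : 'M[F]_n) (R : 'M[F]_m).
Variables (P : 'M[F]_n) (g : F).
Hypotheses (g_gt0 : 0 < g) (Rg : forall u, g * norm2 u ^+ 2 <= dot u (R *m u)).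
Hypotheses (Ppsd : psd P) (Pric : riccati A B Q R P).

Let K := lqr_gain A B R P.
Let Phi := A - B *m K.
Let S := R + B^T *m P *m B.

Lemma coercive_unitmx k (M : 'M[F]_k) :
  (forall u, g * norm2 u ^+ 2 <= dot u (M *m u)) -> M \in unitmx.
Proof.
move=> Mg; rewrite unitmxE unitfE; apply/negP => /det0P[v v0 vM].
move/negP: v0; apply.
have := Mg v^T; rewrite /dot trmxK mulmxA vM mul0mx mxE.
rewrite pmulr_rle0// => h.
have : norm2 v^T = 0 by apply/eqP; rewrite -sqrf_eq0 eq_le h sqr_ge0.
by move/norm2_eq0 => /(congr1 trmx); rewrite trmxK trmx0 => ->.
Qed.

Lemma input_hessian_coercive u : g * norm2 u ^+ 2 <= dot u (S *m u).
Proof.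
rewrite mulmxDl (ipDr (dotP _)); apply: le_trans (Rg u) _; rewrite lerDl.
by rewrite -!mulmxA (ipC (dotP _)) dot_mulmx trmxK (ipC (dotP _)) psd_ge0.
Qed.

Lemma lqr_gainE : S *m K = B^T *m P *m A.
Proof.
rewrite /K /lqr_gain -/S !mulmxA mulmxV ?mul1mx//.
exact: coercive_unitmx input_hessian_coercive.
Qed.

(** For u = -Kx and l = -Px this is the control row of the KKT system; [riccati_closed_loop] is in
    the same way its state row. *)
Lemma lqr_gain_stationary : R *m K = B^T *m (P *m Phi).
Proof.
rewrite /Phi; move: K lqr_gainE => K' SK.
by rewrite !mulmxBr !mulmxA -SK /S mulmxDl addrK.
Qed.

Lemma riccati_closed_loop : P = A^T *m (P *m Phi) + Q.
Proof.
by rewrite {1}Pric /Phi /K /lqr_gain !mulmxBr !mulmxA.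
Qed.

End RiccatiGain.

Section Locality.
Context {F : realType} {n m : nat}.
Variables (A : 'M[F]_n) (B : 'M[F]_(n, m)) (Q : 'M[F]_n) (R : 'M[F]_m).
Variables (P : 'M[F]_n) (L a g Lp : F).
Variables (C : 'M[F]_n) (Kb : 'M[F]_(m, n)) (Kd : 'M[F]_n).
Hypotheses (Qpsd : psd Q) (Rpsd : psd R) (Ppsd : psd P).
Hypotheses (L_ge1 : 1 <= L) (a_bnd : 0 <= a < 1) (g_bnd : 0 < g <= 1).
Hypothesis Lp_ge : L ^+ 3 <= Lp.
Hypotheses (AL : bounded_by A L) (BL : bounded_by B L).
Hypotheses (QL : bounded_by Q L) (RL : bounded_by R L).
Hypothesis PLp : bounded_by P Lp.
Hypothesis Rg : forall u, g * norm2 u ^+ 2 <= dot u (R *m u).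
Hypothesis QC : forall x, dot x (Q *m x) = norm2 (C *m x) ^+ 2.
Hypotheses (KbL : bounded_by Kb L) (KdL : bounded_by Kd L).
Hypothesis Kb_stable : forall t, bounded_by ((A - B *m Kb) ^+ t) (L * a ^+ t).
Hypothesis Kd_stable :
  forall t, bounded_by ((A^T - C^T *m Kd) ^+ t) (L * a ^+ t).
Hypothesis Pric : riccati A B Q R P.

Variables (lo hi : F).
Hypotheses (lo_gt0 : 0 < lo) (lo_lt_hi : lo < hi).
Hypothesis lo_le : 16 * (L / (1 - a)) ^+ 2 * Lp / g <= lo^-1.
Hypothesis hi_ge : 3 * Lp <= hi.

Let K := lqr_gain A B R P.
Let Phi := A - B *m K.
Let q := (hi ^+ 2 - lo ^+ 2) / (hi ^+ 2 + lo ^+ 2).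

Let LLp : L <= Lp.
Proof.
apply: le_trans Lp_ge; rewrite exprS ler_peMr ?exprn_ege1//.
exact: le_trans ler01 L_ge1.
Qed.

Variables (SX : nat -> 'cV[F]_n -> Prop) (SU : nat -> 'cV[F]_m -> Prop).

(** A growing family of subspaces, abstracting what k local operations can reach. It is used with
    the vectors supported near a node, for decay in space, and with the whole space, for decay in
    time alone. *)
Definition subspace_chain (V : lmodType F) (E : nat -> V -> Prop) : Prop :=
  [/\ forall k, E k 0,
      forall k c x y, E k x -> E k y -> E k (c *: x + y)
    & forall k x, E k x -> E k.+1 x].

Lemma subspace_chainD (V : lmodType F) (E : nat -> V -> Prop) k x y :
  subspace_chain E -> E k x -> E k y -> E k (x + y).
Proof. by move=> [_ Elin _] Ex Ey; rewrite -[x]scale1r; exact: Elin. Qed.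

Lemma subspace_chainB (V : lmodType F) (E : nat -> V -> Prop) k x y :
  subspace_chain E -> E k x -> E k y -> E k (x - y).
Proof.
by move=> [_ Elin _] Ex Ey; rewrite addrC -scaleN1r; exact: Elin.
Qed.

Hypotheses (SXc : subspace_chain SX) (SUc : subspace_chain SU).
Hypothesis SA : forall k x, SX k x -> SX k.+1 (A *m x).
Hypothesis SAt : forall k x, SX k x -> SX k.+1 (A^T *m x).
Hypothesis SQ : forall k x, SX k x -> SX k.+1 (Q *m x).
Hypothesis SB : forall k u, SU k u -> SX k.+1 (B *m u).
Hypothesis SBt : forall k x, SX k x -> SU k.+1 (B^T *m x).
Hypothesis SR : forall k u, SU k u -> SU k.+1 (R *m u).

(* Locality in space (through SX and SU) and in time: nothing after time k. *)
Let S (k : nat) (v : @traj F n m) : Prop :=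
  (forall t, [/\ SX k (v.1.1 t), SU k (v.1.2 t) & SX k (v.2 t)]) /\
  (forall t, (k < t)%N -> [/\ v.1.1 t = 0, v.1.2 t = 0 & v.2 t = 0]).

Lemma local_subspace_chain : subspace_chain S.
Proof.
have [X0 Xl Xm] := SXc; have [U0 Ul Um] := SUc; split.
- by move=> k; split.
- move=> k c v w [v1 v2] [w1 w2]; split=> t.
    have [? ? ?] := v1 t; have [? ? ?] := w1 t.
    by split; [exact: Xl|exact: Ul|exact: Xl].
  move=> kt; have [p1 p2 p3] := v2 _ kt; have [r1 r2 r3] := w2 _ kt.
  have fE k' (f f' : nat -> 'cV[F]_k') : f t = 0 -> f' t = 0 ->
      (c *: f + f') t = 0.
    by move=> e1 e2; rewrite -[LHS]/(c *: f t + f' t) e1 e2 scaler0 addr0.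
  by split; exact: fE.
- move=> k v [v1 v2]; split=> t.
    by have [? ? ?] := v1 t; split; [exact: Xm|exact: Um|exact: Xm].
  by move=> kt; apply: v2; exact: ltn_trans kt.
Qed.

(** The dense matrix [P] acts only in the rows t >= T > k, where the state still vanishes; this is
    what bounds the number of iterations by the horizon. *)
Lemma kkt_local T k v : (k < T)%N -> S k v -> S k.+1 (kkt A B Q R P T v).
Proof.
have [X0 Xl Xm] := SXc; have [U0 Ul Um] := SUc.
move=> kT [v1 v2]; split=> t.
  have [x1 u1 l1] := v1 t; split=> /=.
  - apply: subspace_chainD => //; last exact: Xm.
    have [_ _ l2] := v1 t.+1.
    case: ltnP => tT; first by apply: subspace_chainB; auto.
    have [-> _ _] := v2 t (leq_trans kT tT).
    by rewrite mulmx0; exact: X0.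
  - have [_ _ l2] := v1 t.+1.
    by apply: subspace_chainB; auto.
  - apply: subspace_chainB => //; first exact: Xm.
    case: t {x1 u1 l1} => [|t]; first exact: X0.
    by have [? ? _] := v1 t; apply: subspace_chainD; auto.
move=> kt /=; have [-> -> ->] := v2 t (ltnW kt).
have [_ _ ->] := v2 t.+1 (ltnW (ltnW kt)).
rewrite !mulmx0 !subr0 if_same addr0; split=> //; rewrite sub0r.
case: t kt => [//|t] kt; have [-> -> _] := v2 t kt.
by rewrite !mulmx0 addr0 oppr0.
Qed.

Section Optimal.
Variable x0 : 'cV[F]_n.

Definition optimal_traj : @traj F n m :=
  (fun t => Phi ^+ t *m x0, fun t => - (K *m (Phi ^+ t *m x0)),
   fun t => - (P *m (Phi ^+ t *m x0))).

(** It holds for every horizon: with terminal weight [P], the last row asks only that P x + l = 0,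
    which l = -Px satisfies at all times. *)
Lemma kkt_optimal T t :
  [/\ (kkt A B Q R P T optimal_traj).1.1 t = 0,
      (kkt A B Q R P T optimal_traj).1.2 t = 0
    & (kkt A B Q R P T optimal_traj).2 t = if t is 0%N then x0 else 0].
Proof.
have [g0 _] := andP g_bnd.
have PhiS s : Phi ^+ s.+1 *m x0 = Phi *m (Phi ^+ s *m x0).
  by rewrite exprS mulmxA mulmxE.
split=> /=.
- case: ifP => _; last by rewrite subrr.
  rewrite mulmxN opprK PhiS; set y := Phi ^+ t *m x0.
  have -> : P *m y = A^T *m (P *m (Phi *m y)) + Q *m y.
    by rewrite {1}(riccati_closed_loop Pric) mulmxDl -!mulmxA.
  by rewrite [X in X - _]addrC subrr.
- rewrite !mulmxN opprK PhiS; set y := Phi ^+ t *m x0.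
  have e := lqr_gain_stationary A B g0 Rg Ppsd.
  by rewrite [R *m _]mulmxA e -!mulmxA addNr.
- case: t => [|t]; first by rewrite subr0 expr0 mul1mx.
  by rewrite PhiS /Phi mulmxBl mulmxN -mulmxA subrr.
Qed.

Lemma snorm_kkt_optimal T :
  snorm (tip T) (kkt A B Q R P T optimal_traj) = norm2 x0.
Proof.
rewrite norm2E /snorm; congr Num.sqrt; rewrite /tip.
have dot0 k (x y : 'cV[F]_k) : x = 0 -> dot x y = 0.
  by move=> ->; exact: ip0l.
rewrite big1 ?add0r; last by move=> t _; apply: dot0; have [] := kkt_optimal T t.
rewrite big1 ?add0r; last by move=> t _; apply: dot0; have [] := kkt_optimal T t.
rewrite big_ord_recl big1 ?addr0.
  by have [_ _ /= ->] := kkt_optimal T 0.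
by move=> t _; apply: dot0; have [_ _ ->] := kkt_optimal T (lift ord0 t).
Qed.

Lemma optimal_approximation T k : (k.*2 <= T)%N -> SX 0 x0 ->
  exists2 w, S k.*2 w &
    snorm (tip T) (optimal_traj - w) <= q ^+ k / lo * norm2 x0.
Proof.
move=> kT x0S; have [X0 Xl Xm] := SXc; have [U0 Ul Um] := SUc.
have [Sc0 Scl Scm] := local_subspace_chain.
have hi_gt0 : 0 < hi by exact: lt_trans lo_lt_hi.
have Lp_ge1 : 1 <= Lp by exact: le_trans L_ge1 LLp.
have lower v : snorm (tip T) v <= lo^-1 * snorm (tip T) (kkt A B Q R P T v).
  apply: le_trans (kkt_lower_bound T Qpsd Rpsd Ppsd L_ge1 a_bnd g_bnd Lp_ge
    BL QL RL PLp Rg QC KbL KdL Kb_stable Kd_stable v) _.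
  by rewrite ler_wpM2r ?snorm_ge0.
have lb v : lo ^+ 2 * tip T v v
    <= tip T (kkt A B Q R P T v) (kkt A B Q R P T v).
  have := lower v; rewrite ler_pdivlMl// => h.
  rewrite -!(sqr_snorm (tipP T)) -exprMn ler_pXn2r ?nnegrE ?snorm_ge0//.
  by rewrite mulr_ge0 ?snorm_ge0 ?ltW.
have ub v : tip T (kkt A B Q R P T v) (kkt A B Q R P T v)
    <= hi ^+ 2 * tip T v v.
  apply: le_trans (kkt_upper_bound T v Lp_ge1 _ _ _ _ _) _ => //;
    do ?exact: bounded_by_le LLp _.
  apply: ler_wpM2r; first exact: ip_ge0 (tipP T) _.
  by rewrite ler_pXn2r ?nnegrE ?mulr_ge0// ?(ltW hi_gt0) ?(le_trans ler01).
have Hv : S 0%N (kkt A B Q R P T optimal_traj).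
  split=> t; have [e1 e2 e3] := kkt_optimal T t; rewrite e1 e2 e3.
    by split=> //; case: (t).
  by case: t {e1 e2 e3}.
have [w Sw wle] := local_approximation (tipP T) lo_gt0 lo_lt_hi
  (kkt_linear A B Q R P T) (kkt_selfadjoint A B T Qpsd Rpsd Ppsd) lb ub
  Sc0 Scl Scm (@kkt_local T) Hv kT.
exists w => //; apply: le_trans wle _.
rewrite -mulrA ler_wpM2l//.
  apply: exprn_ge0; apply: divr_ge0; last exact: addr_ge0 (sqr_ge0 _) (sqr_ge0 _).
  by rewrite subr_ge0 ler_pXn2r ?nnegrE ?ltW.
by apply: le_trans (lower _) _; rewrite snorm_kkt_optimal.
Qed.

Lemma optimal_gain_local k : SX 0 x0 ->
  exists2 w, SU k.*2 w & norm2 (K *m x0 - w) <= q ^+ k / lo * norm2 x0.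
Proof.
(* The horizon is 2k + 1 and not 2k, so that the control at time 0 is counted in [tip] also for k =
   0. *)
move=> x0S; have [w [w1 _] wle] := optimal_approximation (leqnSn k.*2) x0S.
have [_ Ul Um] := SUc; have [U0 _ _] := SUc.
have [_ wU _] := w1 0%N; exists (- w.1.2 0%N).
  by rewrite -scaleN1r -[_ *: _]addr0; exact: Ul.
apply: le_trans wle; rewrite -norm2N.
rewrite -(@ler_pXn2r _ 2%N) ?nnegrE ?snorm_ge0 ?norm2_ge0//.
rewrite (sqr_snorm (tipP _)) tip_norm2E.
have -> : - (K *m x0 - - w.1.2 0%N) = (optimal_traj - w).1.2 0%N.
  by rewrite -[RHS]/(- (K *m (Phi ^+ 0 *m x0)) - w.1.2 0%N) expr0 mul1mx
     opprB addrC.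
rewrite [X in _ <= _ + X + _]big_ord_recl /= -!addrA addrCA lerDl.
by rewrite !addr_ge0// ?sumr_ge0// => *; exact: sqr_ge0.
Qed.

(** The approximant vanishes after time 2k, so at the horizon [t] the whole optimal state is
    approximation error. *)
Lemma optimal_state_decay k t : SX 0 x0 -> (k.*2 < t)%N ->
  norm2 (Phi ^+ t *m x0) <= q ^+ k / lo * norm2 x0.
Proof.
move=> x0S kt; have [w [_ w2] wle] := optimal_approximation (ltnW kt) x0S.
have [wt _ _] := w2 t kt.
apply: le_trans wle.
rewrite -(@ler_pXn2r _ 2%N) ?nnegrE ?snorm_ge0 ?norm2_ge0//.
rewrite (sqr_snorm (tipP _)) tip_norm2E.
have -> : Phi ^+ t *m x0 = (optimal_traj - w).1.1 t.
  by rewrite -[RHS]/(Phi ^+ t *m x0 - w.1.1 t) wt subr0.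
rewrite big_ord_recr /= -!addrA addrCA lerDl.
by rewrite !addr_ge0// ?sumr_ge0// => *; exact: sqr_ge0.
Qed.

End Optimal.
End Locality.

(** * Perturbed closed loops and costs *)

Section Geometric.
Context {F : realType}.

Lemma geometric_small (C r eps : F) : 0 <= r < 1 -> 0 < eps ->
  exists t : nat, C * r ^+ t <= eps.
Proof.
move=> /andP[r0 r1] e0; have := @cvg_geometric F C r.
rewrite ger0_norm// => /(_ r1) /cvgrPdist_le /(_ eps e0) [t _ /(_ t (leqnn t))].
rewrite /= sub0r normrN => h; exists t.
exact: le_trans (ler_norm _) h.
Qed.

Lemma geometric_sum_le (r : F) T : 0 <= r < 1 ->
  \sum_(t < T) r ^+ t <= (1 - r)^-1.
Proof.
move=> /andP[r0 r1]; have b0 : 0 < 1 - r by rewrite subr_gt0.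
rewrite -[leRHS]mul1r ler_pdivlMr//.
suff -> : (\sum_(t < T) r ^+ t) * (1 - r) = 1 - r ^+ T.
  by rewrite gerBl exprn_ge0.
elim: T => [|T IH]; first by rewrite big_ord0 mul0r expr0 subrr.
by rewrite big_ord_recr /= mulrDl IH exprS; ring.
Qed.

Lemma le_of_geometric_le (y M C r : F) : 0 <= r < 1 ->
  (forall t : nat, y <= M + C * r ^+ t) -> y <= M.
Proof.
move=> r01 h; rewrite leNgt; apply/negP => My.
have e0 : 0 < (y - M) / 2 by rewrite divr_gt0// subr_gt0.
have [t ht] := geometric_small C r01 e0.
have := h t; lra.
Qed.

End Geometric.

Section ClosedLoop.
Context {F : realType} {n : nat}.
Variables (Phi D : 'M[F]_n) (c r phi eps W : F) (x : nat -> 'cV[F]_n).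
Hypotheses (c_ge0 : 0 <= c) (r_bnd : 0 <= r < 1).
Hypothesis Phi_decay : forall t, bounded_by (Phi ^+ t) (c * r ^+ t).
Hypothesis W_ge : c ^+ 2 / (1 - r ^+ 2) <= W.
Hypotheses (phi_ge0 : 0 <= phi) (eps_ge0 : 0 <= eps).
Hypotheses (Phi_phi : bounded_by Phi phi) (D_eps : bounded_by D eps).
Hypothesis small : W * (2 * phi * eps + eps ^+ 2) <= 4^-1.
Hypothesis xS : forall t, x t.+1 = (Phi - D) *m x t.

Let r2_bnd : 0 <= r ^+ 2 < 1.
Proof. by have [r0 r1] := andP r_bnd; rewrite sqr_ge0 expr_lt1. Qed.

Let decay_sum M : \sum_(t < M) (c * r ^+ t) ^+ 2 <= W.
Proof.
apply: le_trans W_ge.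
under eq_bigr do rewrite exprMn -exprM mulnC exprM.
rewrite -mulr_sumr ler_wpM2l ?sqr_ge0//.
exact: geometric_sum_le.
Qed.

(* V y = sum_(t < M) |Phi^t y|^2 is a Lyapunov function of the perturbed loop
   once M is so large that |Phi^M|^2 <= 1/4. *)
Lemma perturbed_loop_sum T :
  \sum_(t < T) norm2 (x t) ^+ 2 <= 2 * W * norm2 (x 0%N) ^+ 2.
Proof.
have [M hM] : exists M, c ^+ 2 * (r ^+ 2) ^+ M <= 4^-1.
  by apply: geometric_small => //; rewrite invr_gt0.
pose V y := \sum_(t < M) norm2 (Phi ^+ t *m y) ^+ 2.
have W0 : 0 <= W by have := decay_sum 0; rewrite big_ord0.
have PhiB t y : norm2 (Phi ^+ t *m y) ^+ 2 <= (c * r ^+ t) ^+ 2 * norm2 y ^+ 2.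
  apply: sqr_bounded_by => //; have [r0 _] := andP r_bnd.
  by rewrite mulr_ge0 ?exprn_ge0.
have VW y : V y <= W * norm2 y ^+ 2.
  apply: le_trans (_ : \sum_(t < M) (c * r ^+ t) ^+ 2 * norm2 y ^+ 2 <= _).
    by apply: ler_sum => t _; exact: PhiB.
  by rewrite -mulr_suml ler_wpM2r ?sqr_ge0.
have VS y : V ((Phi - D) *m y) <= V y - 2^-1 * norm2 y ^+ 2.
  pose k := 2 * phi * eps + eps ^+ 2.
  have smallk : W * k <= 4^-1 by exact: small.
  (* Under [Phi] an untruncated sum would drop by |y|^2. Cutting it at [M] costs a quarter of this
     and the perturbation [D] another quarter, which leaves the half in [VS]. *)
  have shift : \sum_(t < M) norm2 (Phi ^+ t.+1 *m y) ^+ 2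
      <= V y - (3 / 4) * norm2 y ^+ 2.
    have : \sum_(t < M.+1) norm2 (Phi ^+ t *m y) ^+ 2
        = norm2 y ^+ 2 + \sum_(t < M) norm2 (Phi ^+ t.+1 *m y) ^+ 2.
      by rewrite big_ord_recl /= expr0 mul1mx.
    rewrite big_ord_recr /= -/(V y) => e.
    have h : norm2 (Phi ^+ M *m y) ^+ 2 <= 4^-1 * norm2 y ^+ 2.
      apply: le_trans (PhiB M y) _; rewrite ler_wpM2r ?sqr_ge0//.
      by rewrite exprMn -exprM mulnC exprM.
    lra.
  have cross : norm2 (Phi *m y) * norm2 (D *m y) *+ 2 + norm2 (D *m y) ^+ 2
      <= k * norm2 y ^+ 2.
    have e1 := Phi_phi y; have e2 := D_eps y.
    have p1 : norm2 (Phi *m y) * norm2 (D *m y)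
        <= (phi * norm2 y) * (eps * norm2 y) by rewrite ler_pM ?norm2_ge0.
    have p2 : norm2 (D *m y) ^+ 2 <= eps ^+ 2 * norm2 y ^+ 2.
      exact: sqr_bounded_by.
    by rewrite /k mulr2n; lra.
  have term (t : 'I_M) : norm2 (Phi ^+ t *m ((Phi - D) *m y)) ^+ 2 <=
      norm2 (Phi ^+ t.+1 *m y) ^+ 2 + (c * r ^+ t) ^+ 2 * (k * norm2 y ^+ 2).
    rewrite mulmxBl mulmxBr [Phi ^+ t *m (Phi *m y)]mulmxA mulmxE -exprSr.
    set p := Phi ^+ t.+1 *m y; set s := Phi ^+ t *m (D *m y).
    have [r0 _] := andP r_bnd.
    have cr0 : 0 <= c * r ^+ t by rewrite mulr_ge0 ?exprn_ge0.
    have hp : norm2 p <= c * r ^+ t * norm2 (Phi *m y).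
      by rewrite /p exprSr -mulmxE -mulmxA; exact: Phi_decay.
    have hs : norm2 s <= c * r ^+ t * norm2 (D *m y) by exact: Phi_decay.
    apply: le_trans (_ : (norm2 p + norm2 s) ^+ 2 <= _).
      by rewrite ler_pXn2r ?nnegrE ?addr_ge0 ?norm2_ge0// norm2B.
    rewrite sqrrD -addrA lerD2l.
    have h := ler_wpM2l (sqr_ge0 (c * r ^+ t)) cross.
    apply: le_trans h.
    have h1 : norm2 p * norm2 s <= (c * r ^+ t * norm2 (Phi *m y)) *
        (c * r ^+ t * norm2 (D *m y)) by rewrite ler_pM ?norm2_ge0.
    have h2 : norm2 s ^+ 2 <= (c * r ^+ t * norm2 (D *m y)) ^+ 2.
      rewrite ler_pXn2r ?nnegrE ?norm2_ge0//.
      exact: mulr_ge0 cr0 (norm2_ge0 _).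
    by rewrite !mulr2n; lra.
  apply: le_trans (ler_sum _ (fun t _ => term t)) _.
  rewrite big_split /= -mulr_suml.
  have h : \sum_(t < M) (c * r ^+ t) ^+ 2 * (k * norm2 y ^+ 2)
      <= 4^-1 * norm2 y ^+ 2.
    rewrite -mulr_suml mulrA ler_wpM2r ?sqr_ge0//; apply: le_trans smallk.
    by rewrite ler_wpM2r ?decay_sum// /k addr_ge0 ?mulr_ge0 ?sqr_ge0.
  rewrite -mulr_suml in h; lra.
have main : \sum_(t < T) norm2 (x t) ^+ 2 <= 2 * (V (x 0%N) - V (x T)).
  elim: (T) => [|s IH]; first by rewrite big_ord0 subrr mulr0.
  by rewrite big_ord_recr /= [x s.+1]xS; have := VS (x s); lra.
have VT : 0 <= V (x T) by apply: sumr_ge0 => t _; exact: sqr_ge0.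
by have := VW (x 0%N); lra.
Qed.

End ClosedLoop.

(** * Cost of a linear policy, and bounds on the Riccati solution and gain *)

Section Performance.
Context {F : realType} {n m : nat}.
Variables (A : 'M[F]_n) (B : 'M[F]_(n, m)) (Q : 'M[F]_n) (R : 'M[F]_m).
Variables (P : 'M[F]_n) (g : F).
Hypotheses (g_gt0 : 0 < g) (Rg : forall u, g * norm2 u ^+ 2 <= dot u (R *m u)).
Hypotheses (Qpsd : psd Q) (Rpsd : psd R) (Ppsd : psd P).
Hypothesis Pric : riccati A B Q R P.

Let K := lqr_gain A B R P.
Let S := R + B^T *m P *m B.

Lemma input_hessian_psd : psd S.
Proof.
have [Rs R0] := Rpsd; have [Ps P0] := Ppsd; split=> [|u].
  by rewrite linearD /= !trmx_mul trmxK Rs Ps mulmxA.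
rewrite -mulmxA -/(dot u _); apply: le_trans (input_hessian_coercive B Rg Ppsd u).
by rewrite mulr_ge0 ?sqr_ge0// ltW.
Qed.

(** This is the Bellman equation with its defect: the value x'Px is missed exactly by the square of
    the deviation of [u] from -Kx. Along any trajectory it telescopes, so costs of arbitrary gains
    can be compared without a minimization argument. *)
Lemma riccati_completion x u :
  dot x (Q *m x) + dot u (R *m u)
    + dot (A *m x + B *m u) (P *m (A *m x + B *m u))
  = dot x (P *m x) + dot (u + K *m x) (S *m (u + K *m x)).
Proof.
have Pi := psd_semi_inner Ppsd; have Si := psd_semi_inner input_hessian_psd.
have PE : dot x (P *m x) = dot x (Q *m x)
    + dot (A *m x) (P *m (A *m x)) - dot (A *m x) (P *m (B *m (K *m x))).
  rewrite {1}(riccati_closed_loop Pric) mulmxDl (ipDr (dotP _)) addrC -addrA.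
  congr (_ + _).
  rewrite -mulmxA -dot_mulmx -mulmxA mulmxBl mulmxBr (ipDr (dotP _)).
  by rewrite (ipNr (dotP _)) -mulmxA.
have SE w : dot w (S *m (K *m x)) = dot (B *m w) (P *m (A *m x)).
  by rewrite mulmxA (lqr_gainE A B g_gt0 Rg Ppsd) -!mulmxA -dot_mulmx.
have SE' w : dot w (S *m w) = dot w (R *m w) + dot (B *m w) (P *m (B *m w)).
  by rewrite mulmxDl (ipDr (dotP _)) -!mulmxA -dot_mulmx.
have e1 := ipDl Pi (A *m x) (B *m u); have e2 := ipDr Pi (A *m x) (B *m u).
have s1 := ipDl Si u (K *m x); have s2 := ipDr Si u (K *m x).
rewrite e1 !e2 s1 !s2 PE SE' !SE.
rewrite (ipC Si (K *m x) u) SE.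
rewrite (ipC Pi (B *m (K *m x))) (ipC Pi (A *m x) (B *m u)).
ring.
Qed.

Lemma stage_costE x u : stage_cost Q R x u
  = 2^-1 * (dot x (Q *m x) + dot u (R *m u)).
Proof. by rewrite mulrDr /stage_cost -!mulmxA. Qed.

Section Policy.
Variables (K' : 'M[F]_(m, n)) (x0 : 'cV[F]_n).
Let x := state A B (linear_policy K') x0.

Lemma state_linear t : x t = (A - B *m K') ^+ t *m x0.
Proof.
elim: t => [|t IH]; first by rewrite expr0 mul1mx.
rewrite exprS -mulmxE -mulmxA -IH /x /= /linear_policy mulmxN mulmxBl.
by rewrite -mulmxA.
Qed.

Lemma cost_partial_sum T :
  \sum_(t < T) stage_cost Q R (x t) (linear_policy K' (x t))
  = 2^-1 * (dot x0 (P *m x0) - dot (x T) (P *m x T)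
      + \sum_(t < T) dot ((K - K') *m x t) (S *m ((K - K') *m x t))).
Proof.
elim: T => [|T IH]; first by rewrite !big_ord0 subrr addr0 mulr0.
rewrite !big_ord_recr /= {}IH.
have := riccati_completion (x T) (linear_policy K' (x T)).
rewrite -[A *m _ + _]/(x T.+1) => e.
have -> : (K - K') *m x T = linear_policy K' (x T) + K *m x T.
  by rewrite mulmxBl addrC.
rewrite stage_costE.
move: e; set s := dot _ (Q *m _); set s' := dot _ (R *m _).
by move=> e; lra.
Qed.

Lemma stage_cost_ge0 t :
  0 <= stage_cost Q R (x t) (linear_policy K' (x t)).
Proof.
by rewrite stage_costE mulr_ge0// addr_ge0// psd_ge0.
Qed.

Lemma J_ge (M : F) :
  (forall eps, 0 < eps -> exists T, M - eps <=
     \sum_(t < T) stage_cost Q R (x t) (linear_policy K' (x t))) ->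
  (M%:E <= J A B Q R (linear_policy K') x0)%E.
Proof.
move=> h; apply/lee_addgt0Pr => e e0; have [T hT] := h e e0.
rewrite -leeBlDr//; apply: le_trans (_ : _ <= (\sum_(0 <= t < T)
  (stage_cost Q R (x t) (linear_policy K' (x t)))%:E)%E)%E _; last first.
  by apply: nneseries_lim_ge => t _ _; rewrite lee_fin stage_cost_ge0.
by rewrite sumEFin big_mkord lee_fin.
Qed.

Lemma J_le (M : F) :
  (forall T, \sum_(t < T) stage_cost Q R (x t) (linear_policy K' (x t)) <= M) ->
  (J A B Q R (linear_policy K') x0 <= M%:E)%E.
Proof.
move=> h; apply: lime_le.
  by apply: is_cvg_nneseries_cond => t _ _; rewrite lee_fin stage_cost_ge0.
by apply: nearW => T; rewrite sumEFin big_mkord lee_fin.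
Qed.

End Policy.

(** The square in [riccati_completion] is dropped for the suboptimal policy -Kb x, whose cost then
    dominates x'Px. A stage costs at most (L + L^3) |x(t)|^2 with |x(t)| <= L a^t |y|, and the
    geometric sum yields the constant [LP]. *)
Lemma riccati_bound (L a : F) (Kb : 'M[F]_(m, n)) : 0 <= L -> 0 <= a < 1 ->
  bounded_by Q L -> bounded_by R L -> bounded_by Kb L ->
  (forall t, bounded_by ((A - B *m Kb) ^+ t) (L * a ^+ t)) ->
  bounded_by P (L ^+ 3 * (1 + L ^+ 2) / (1 - a ^+ 2)).
Proof.
move=> L0 /andP[a0 a1] QL RL KbL Ks.
have a2 : 0 <= a ^+ 2 < 1 by rewrite sqr_ge0 expr_lt1.
have b0 : 0 < 1 - a ^+ 2 by have /andP[_ ?] := a2; rewrite subr_gt0.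
apply: psd_bounded_by => [||y] //.
  apply: divr_ge0; last exact: ltW.
  exact: mulr_ge0 (exprn_ge0 _ L0) (addr_ge0 ler01 (sqr_ge0 _)).
(* This a priori constant affects only the terminal term, which tends to 0 with the horizon. *)
have [c c0 Pc] := bounded_by_exists P.
pose x t := (A - B *m Kb) ^+ t *m y.
have xb t : norm2 (x t) ^+ 2 <= L ^+ 2 * norm2 y ^+ 2 * (a ^+ 2) ^+ t.
  apply: le_trans (sqr_bounded_by y _ (Ks t)) _.
    by rewrite mulr_ge0 ?exprn_ge0.
  by rewrite exprMn -!exprM mulnC mulrAC.
have step t : dot (x t) (P *m x t) <= (L + L ^+ 3) * norm2 (x t) ^+ 2
    + dot (x t.+1) (P *m x t.+1).
  have := riccati_completion (x t) (- (Kb *m x t)).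
  have -> : A *m x t + B *m - (Kb *m x t) = x t.+1.
    by rewrite /x exprS -mulmxE -mulmxA mulmxBl mulmxN -mulmxA.
  have := psd_ge0 (- (Kb *m x t) + K *m x t) input_hessian_psd.
  have := psd_dot_le (x t) QL; have := psd_dot_le (- (Kb *m x t)) RL.
  have := ler_wpM2l L0 (sqr_bounded_by (x t) L0 KbL).
  by rewrite norm2N; lra.
apply: (@le_of_geometric_le _ _ _ (c * L ^+ 2 * norm2 y ^+ 2) (a ^+ 2)) => // T.
have LL0 : 0 <= L + L ^+ 3 by rewrite addr_ge0 ?exprn_ge0.
have sum : dot y (P *m y) <= \sum_(t < T) (L + L ^+ 3) * norm2 (x t) ^+ 2
    + dot (x T) (P *m x T).
  elim: T => [|T IH]; first by rewrite big_ord0 add0r /x expr0 mul1mx.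
  by rewrite big_ord_recr /=; have := step T; lra.
apply: le_trans sum _; apply: lerD; last first.
  apply: le_trans (psd_dot_le _ Pc) _.
  by apply: le_trans (ler_wpM2l c0 (xb T)) _; apply: ler_of_eq; ring.
apply: le_trans (_ : \sum_(t < T)
    (L ^+ 3 * (1 + L ^+ 2)) * norm2 y ^+ 2 * (a ^+ 2) ^+ t <= _).
  apply: ler_sum => t _; apply: le_trans (ler_wpM2l LL0 (xb t)) _.
  by apply: ler_of_eq; ring.
rewrite -mulr_sumr.
have k0 : 0 <= L ^+ 3 * (1 + L ^+ 2) * norm2 y ^+ 2.
  apply: mulr_ge0 (sqr_ge0 _).
  exact: mulr_ge0 (exprn_ge0 _ L0) (addr_ge0 ler01 (sqr_ge0 _)).
apply: le_trans (ler_wpM2l k0 (geometric_sum_le T a2)) _.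
by apply: ler_of_eq; ring.
Qed.

Section Bounds.
Variables (L Lp : F).
Hypotheses (L_ge0 : 0 <= L) (Lp_ge0 : 0 <= Lp).
Hypotheses (AL : bounded_by A L) (BL : bounded_by B L) (RL : bounded_by R L).
Hypothesis PLp : bounded_by P Lp.

(** Coercivity of [S] tested on Ky: g |Ky|^2 <= <Ky, S K y> = <Ky, B'PA y>. *)
Lemma lqr_gain_bound : bounded_by K (Lp * L ^+ 2 / g).
Proof.
move=> y; have := input_hessian_coercive B Rg Ppsd (K *m y).
rewrite mulmxA (lqr_gainE A B g_gt0 Rg Ppsd).
set w := norm2 (K *m y) => h.
rewrite mulrAC ler_pdivlMr// mulrC.
have : 0 <= w by exact: norm2_ge0.
rewrite le_eqVlt => /predU1P[<-|w0].
  by rewrite mulr0 !mulr_ge0 ?sqr_ge0 ?norm2_ge0.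
rewrite -(ler_pM2l w0).
have e : w * (g * w) = g * w ^+ 2 by ring.
rewrite e; apply: le_trans h _; apply: le_trans (dot_le _ _) _.
rewrite -/w ler_wpM2l ?norm2_ge0//.
have BtL := bounded_by_tr L_ge0 BL.
have := bounded_by_mul (mulr_ge0 L_ge0 Lp_ge0)
  (bounded_by_mul L_ge0 BtL PLp) AL y.
by move=> h'; apply: le_trans h' _; apply: ler_of_eq; ring.
Qed.

Lemma input_hessian_bound : bounded_by S (L + L ^+ 2 * Lp).
Proof.
move=> y; rewrite mulmxDl; apply: le_trans (norm2D _ _) _; rewrite mulrDl.
apply: lerD; first exact: RL.
have BtL := bounded_by_tr L_ge0 BL.
have := bounded_by_mul (mulr_ge0 L_ge0 Lp_ge0)
  (bounded_by_mul L_ge0 BtL PLp) BL y.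
by move=> h'; apply: le_trans h' _; apply: ler_of_eq; ring.
Qed.

Lemma closed_loop_bound : bounded_by (A - B *m K) (L * (1 + Lp * L ^+ 2 / g)).
Proof.
move=> y; rewrite mulmxBl; apply: le_trans (norm2B _ _) _.
rewrite mulrDr mulr1 mulrDl; apply: lerD; first exact: AL.
exact: bounded_by_mul L_ge0 BL lqr_gain_bound y.
Qed.

End Bounds.

End Performance.

(** * The constants *)

(** For t > 0 the largest k with 2k < t is (t - 1) / 2, rounded down; the rounding loses at most two
    units of distance. *)
Lemma leq_double_half_pred t : (t <= (t.-1./2).+1.*2)%N.
Proof.
case: t => //= t; rewrite doubleS ltnS -{1}[t]odd_double_half.
by case: (odd t).
Qed.

Section ConstantBounds.
Context {F : realType}.
Variables (L a g : F) (p : nat -> F).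
Hypotheses (L_gt1 : 1 < L) (a_bnd : 0 < a < 1) (g_bnd : 0 < g < 1).

Let L_gt0 : 0 < L. Proof. exact: lt_trans ltr01 L_gt1. Qed.
Let b_gt0 : 0 < 1 - a. Proof. by have /andP[_ ?] := a_bnd; rewrite subr_gt0. Qed.
Let g_gt0 : 0 < g. Proof. by case/andP: g_bnd. Qed.
Let a2_lt1 : a ^+ 2 < 1.
Proof. by have /andP[? ?] := a_bnd; rewrite expr_lt1// ltW. Qed.

Lemma LP_ge : L ^+ 3 <= LP L a.
Proof.
have L3 : 0 < L ^+ 3 by rewrite exprn_gt0.
rewrite /LP ler_pdivlMr ?subr_gt0// ler_pM2l//.
by have := sqr_ge0 L; have := sqr_ge0 a; lra.
Qed.

Lemma LP_ge1 : 1 <= LP L a.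
Proof. by apply: le_trans LP_ge; rewrite exprn_ege1// ltW. Qed.

Lemma LH_ge_LP : LP L a + 1 <= LH L a.
Proof. by rewrite /LH le_max lexx orbT. Qed.

Lemma LH_ge3 : 3 <= LH L a.
Proof. by rewrite /LH le_max; apply/orP; left; have := L_gt1; lra. Qed.

Let LH_gt0 : 0 < LH L a. Proof. exact: lt_le_trans LH_ge3. Qed.

Lemma gammaF_gt0 : 0 < gammaF L a.
Proof. by rewrite /gammaF divr_gt0 ?mulr_gt0 ?exprn_gt0// addr_gt0. Qed.

Lemma gammaG_gt0 : 0 < gammaG L a g.
Proof. by rewrite /gammaG divr_gt0 ?mulr_gt0 ?exprn_gt0// addr_gt0. Qed.

Lemma gammaF_le1 : gammaF L a <= 1.
Proof.
have d0 : 0 < L ^+ 2 * (1 + L) ^+ 2 by rewrite mulr_gt0 ?exprn_gt0// addr_gt0.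
rewrite /gammaF ler_pdivrMr// mul1r.
apply: (@le_trans _ _ 1).
  rewrite exprn_ile1 ?ltW//; have /andP[a0 _] := a_bnd.
  by rewrite gtrBl.
by apply: mulr_ege1; rewrite exprn_ege1//; have := L_gt1; lra.
Qed.

Lemma gammaG_inv_ge : 8 * (L / (1 - a)) ^+ 2 / g <= (gammaG L a g)^-1.
Proof.
rewrite /gammaG invf_div.
have e : 2 * L ^+ 4 * (1 + L) ^+ 2 / ((1 - a) ^+ 2 * g)
  = 2 * (L ^+ 2 * (1 + L) ^+ 2) * (L / (1 - a)) ^+ 2 / g.
  by field; rewrite !gt_eqF.
rewrite e ler_pM2r ?invr_gt0// ler_pM2r ?exprn_gt0 ?divr_gt0//.
have h1 : 1 <= L ^+ 2 by rewrite exprn_ege1 ?ltW.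
have h2 : 2 ^+ 2 <= (1 + L) ^+ 2.
  by rewrite ler_pXn2r ?nnegrE//; have := L_gt1; lra.
have := ler_pM ler01 (sqr_ge0 _) h1 h2; lra.
Qed.

Let c2_ge1 : 1 <= (L / (1 - a)) ^+ 2.
Proof.
rewrite exprn_ege1// ler_pdivlMr// mul1r.
by have /andP[? ?] := a_bnd; have := L_gt1; lra.
Qed.

Let cg_ge1 : 1 <= (L / (1 - a)) ^+ 2 / g.
Proof.
have /andP[_ g1] := g_bnd; apply: mulr_ege1 => //.
by rewrite invf_ge1// ltW.
Qed.

Let mubar_ge : 2 * LH L a ^+ 2 / gammaG L a g <= mubar L a g.
Proof.
have f0 := gammaF_gt0; have g0 := gammaG_gt0.
have h : 2 * LH L a ^+ 2 / gammaG L a g <=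
   2 * LH L a ^+ 2 / gammaG L a g + gammaG L a g + LH L a.
  by rewrite -addrA lerDl addr_ge0// ltW.
rewrite /mubar ler_pdivlMr//; apply: le_trans h.
apply: ler_piMr gammaF_le1; apply: divr_ge0 (ltW g0).
exact: mulr_ge0 (sqr_ge0 _).
Qed.

(** This links the coercivity constant of [kkt_lower_bound] with [gammaH], as 48 = 3 * 16. The
    middle summand of 1 / gammaH is at least LH * mubar, and mubar >= 2 LH^2 / gammaG >= 2 * 9 * 8
    times c^2 / g, where c = L / (1 - a). *)
Lemma gammaH_inv_ge : 48 * (L / (1 - a)) ^+ 2 * LP L a / g <= (gammaH L a g)^-1.
Proof.
rewrite /gammaH invrK.
have f0 := gammaF_gt0; have f1 := gammaF_le1; have G0 := gammaG_gt0.
have H3 := LH_ge3; have Gi := gammaG_inv_ge; have mu := mubar_ge.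
have Gi0 : 0 < (gammaG L a g)^-1 by rewrite invr_gt0.
have HP := LH_ge_LP; have P1 := LP_ge1.
have cg1 := cg_ge1; pose cg := (L / (1 - a)) ^+ 2 / g; rewrite -/cg in cg1.
have {}Gi : 8 * cg <= (gammaG L a g)^-1 by rewrite /cg mulrA.
have -> : 48 * (L / (1 - a)) ^+ 2 * LP L a / g = 48 * cg * LP L a.
  by rewrite /cg; ring.
have H2 : 9 <= LH L a ^+ 2 by have := ler_pM _ _ H3 H3; rewrite expr2; lra.
have mu0 : 144 * cg <= mubar L a g.
  apply: le_trans mu.
  have := ler_pM _ _ H2 Gi; lra.
have mupos : 0 <= mubar L a g by apply: le_trans mu0; lra.
have h1 : LH L a * mubar L a g <= LH L a * (1 + mubar L a g * LH L a) / gammaF L a.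
  rewrite ler_pdivlMr//; apply: (@le_trans _ _ (LH L a * mubar L a g)).
    by apply: ler_piMr f1; exact: mulr_ge0 (ltW LH_gt0) mupos.
  apply: ler_wpM2l; first exact: ltW.
  have : mubar L a g * 1 <= mubar L a g * LH L a by rewrite ler_wpM2l//; lra.
  by lra.
have h2 : LH L a * (1 + mubar L a g * LH L a) / gammaF L a <=
   (1 + 4 * LH L a / gammaG L a g + 4 * LH L a ^+ 2 / gammaG L a g ^+ 2)
     * (LH L a * (1 + mubar L a g * LH L a) / gammaF L a).
  rewrite ler_peMl//.
    by apply: le_trans h1; exact: mulr_ge0 (ltW LH_gt0) mupos.
  rewrite -addrA lerDl; apply: addr_ge0.
    by apply: divr_ge0 (ltW G0); exact: mulr_ge0 (ltW LH_gt0).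
  by apply: divr_ge0 (sqr_ge0 _); exact: mulr_ge0 (sqr_ge0 _).
have h3 : 48 * cg * LP L a <= LH L a * mubar L a g.
  have cgP : 0 <= cg * LP L a by rewrite mulr_ge0//; lra.
  have : LP L a * (144 * cg) <= LH L a * mubar L a g.
    by apply: ler_pM; lra.
  by lra.
have h4 : 0 <= 2 / gammaG L a g by exact: divr_ge0 (ltW G0).
by move: h1 h2 h3 h4 mupos; set u := _ * (_ / gammaF L a); set v := _ / gammaF L a; lra.
Qed.

Lemma gammaH_gt0 : 0 < gammaH L a g.
Proof.
rewrite -invr_gt0; apply: lt_le_trans gammaH_inv_ge.
have h1 := LP_ge1; have h2 := c2_ge1.
by apply: divr_gt0 => //; apply: mulr_gt0; lra.
Qed.

Lemma gammaH_le1 : gammaH L a g <= 1.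
Proof.
rewrite -(invf_ge1 gammaH_gt0); apply: le_trans gammaH_inv_ge.
by have := ler_pM ler01 ler01 cg_ge1 LP_ge1; lra.
Qed.

Lemma sqr_rho : rho L a g ^+ 2 = (LH L a ^+ 2 - gammaH L a g ^+ 2)
  / (LH L a ^+ 2 + gammaH L a g ^+ 2).
Proof.
have H0 := gammaH_gt0; have H1 := gammaH_le1; have H3 := LH_ge3.
rewrite sqr_sqrtr//; apply: divr_ge0; last by rewrite addr_ge0 ?sqr_ge0.
by rewrite subr_ge0 ler_pXn2r ?nnegrE//; lra.
Qed.

Let den_gt0 : 0 < LH L a ^+ 2 + gammaH L a g ^+ 2.
Proof. by rewrite addr_gt0 ?exprn_gt0 ?gammaH_gt0. Qed.

(** It prices the rounding to whole iteration steps: a missing factor rho^2 costs at most 2. *)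
Lemma sqr_rho_ge : 2^-1 <= rho L a g ^+ 2.
Proof.
have H0 := gammaH_gt0; have H1 := gammaH_le1; have H3 := LH_ge3.
rewrite sqr_rho ler_pdivlMr//.
have h1 : gammaH L a g ^+ 2 <= 1 by rewrite exprn_ile1// ltW.
have h2 : 3 ^+ 2 <= LH L a ^+ 2 by rewrite ler_pXn2r ?nnegrE//; lra.
lra.
Qed.

Lemma sqr_rho_lt1 : rho L a g ^+ 2 < 1.
Proof.
rewrite sqr_rho ltr_pdivrMr// mul1r.
by have := exprn_gt0 2 gammaH_gt0; lra.
Qed.

Lemma rho_gt0 : 0 < rho L a g.
Proof.
have r0 : 0 <= rho L a g by exact: sqrtr_ge0.
rewrite lt_neqAle r0 andbT; apply/eqP => e.
by have := sqr_rho_ge; rewrite -e expr0n/=; lra.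
Qed.

Lemma rho_lt1 : rho L a g < 1.
Proof.
by have := sqr_rho_lt1; rewrite expr_lt1// ltW// rho_gt0.
Qed.

Lemma Upsilon_ge : 3 / gammaH L a g <= Upsilon L a g.
Proof.
have H0 := gammaH_gt0; have H1 := gammaH_le1; have H3 := LH_ge3.
have r0 := rho_gt0; have r1 := rho_lt1.
rewrite /Upsilon ler_pdivlMr ?mulr_gt0 ?exprn_gt0//.
have -> : 3 / gammaH L a g * (gammaH L a g ^+ 2 * rho L a g)
  = 3 * (gammaH L a g * rho L a g) by field; rewrite gt_eqF.
have : gammaH L a g * rho L a g <= 1 by apply: mulr_ile1 => //; exact: ltW.
lra.
Qed.

Lemma Upsilon_ge3 : 3 <= Upsilon L a g.
Proof.
apply: le_trans Upsilon_ge; rewrite ler_peMr// invf_ge1 ?gammaH_gt0//.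
exact: gammaH_le1.
Qed.

(* k = (t-1)/2 is the number of Richardson steps affordable at distance t. *)
Lemma decay_constant t : (0 < t)%N ->
  (rho L a g ^+ 2) ^+ t.-1./2 / (3 * gammaH L a g)
    <= Upsilon L a g / 2 * rho L a g ^+ t.
Proof.
move=> t0; have H0 := gammaH_gt0; have U := Upsilon_ge.
have r0 := rho_gt0; have r1 := rho_lt1; have r2 := sqr_rho_ge.
have h1 : (rho L a g ^+ 2) ^+ (t.-1./2).+1 <= rho L a g ^+ t.
  rewrite -exprM; apply: ler_wiXn2l; [exact: ltW|exact: ltW|].
  by rewrite mul2n; exact: leq_double_half_pred.
have h2 : (rho L a g ^+ 2) ^+ t.-1./2 <= 2 * rho L a g ^+ t.
  move: h1; rewrite exprS; set y := _ ^+ t.-1./2 => h1.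
  have y0 : 0 <= y by apply: exprn_ge0; exact: sqr_ge0.
  have := ler_wpM2r y0 r2; lra.
rewrite ler_pdivrMr ?mulr_gt0//; apply: le_trans h2 _.
move: U; rewrite ler_pdivrMr// => U.
have rt : 0 <= rho L a g ^+ t by apply: exprn_ge0; exact: ltW.
have := ler_wpM2r rt U; lra.
Qed.

Lemma sqr_Omega : Omega L a g ^+ 2 = Upsilon L a g ^+ 2 / (1 - rho L a g ^+ 2).
Proof. by rewrite sqr_sqrtr// divr_ge0 ?sqr_ge0// subr_ge0 ltW// sqr_rho_lt1. Qed.

(** Unfolding [beta], the gap is (1 - rho^2) / (2 Upsilon^2). The division by it in [Gamma] can only
    enlarge the bound. *)
Lemma beta_gap_le1 : 0 < 1 - beta L a g ^+ 2 <= 1.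
Proof.
have U := Upsilon_ge3; have r1 := sqr_rho_lt1; have r2 := sqr_ge0 (rho L a g).
have U2 : 0 < 2 * Upsilon L a g ^+ 2 by rewrite mulr_gt0// exprn_gt0//; lra.
have U3 : 1 <= 2 * Upsilon L a g ^+ 2.
  by have : 1 <= Upsilon L a g ^+ 2; [rewrite exprn_ege1//; lra|lra].
have q0 : 0 < (1 - rho L a g ^+ 2) / (2 * Upsilon L a g ^+ 2).
  by rewrite divr_gt0// subr_gt0.
have q1 : (1 - rho L a g ^+ 2) / (2 * Upsilon L a g ^+ 2) <= 1.
  by rewrite ler_pdivrMr// mul1r; lra.
rewrite sqr_sqrtr; last by rewrite subr_ge0.
by rewrite opprB addrC subrK q0.
Qed.

Lemma delta_gt0 : 0 < delta L a g.
Proof. by rewrite /delta; have := rho_gt0; lra. Qed.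

Lemma delta_lt1 : delta L a g < 1.
Proof. by rewrite /delta; have := rho_lt1; lra. Qed.

Lemma rho_lt_delta : rho L a g < delta L a g.
Proof. by rewrite /delta; have := rho_lt1; lra. Qed.

Hypothesis p_subexp : subexponential p.

(** Since rho / delta < 1, subexponential growth makes the sequence converge to 0, hence bounded;
    only then is [sup] an upper bound. *)
Lemma subexp_le_sup d : p d * (rho L a g / delta L a g) ^+ d <=
  sup (range (fun d : nat => p d * (rho L a g / delta L a g) ^+ d)).
Proof.
apply: ub_le_sup; last by exists d.
have [_ /(_ (rho L a g / delta L a g)) pr] := p_subexp.
have /pr/cvgP/cvg_seq_bounded : 0 < rho L a g / delta L a g < 1.
  rewrite divr_gt0 ?rho_gt0 ?delta_gt0//.
  by rewrite ltr_pdivrMr ?delta_gt0// mul1r rho_lt_delta.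
case=> M [_ /(_ (M + 1))]; rewrite ltrDl ltr01 => /(_ isT) hM.
by exists (M + 1) => _ [k _ <-]; apply: le_trans (ler_norm _) (hM k I).
Qed.

Lemma Psi_ge0 : 0 <= Psi L a g p.
Proof.
have [p0 _] := p_subexp; have d0 := delta_gt0; have d1 := delta_lt1.
have U := Upsilon_ge3; apply: mulr_ge0.
  apply: le_trans (subexp_le_sup 0); rewrite expr0 mulr1; exact: p0.
by apply: divr_ge0; [apply: mulr_ge0; lra|lra].
Qed.

(** This explains [Psi]: the supremum trades p(d) rho^d for a multiple of delta^d, and the geometric
    tail from k + 1 on contributes delta / (1 - delta). *)
Lemma subexp_tail_le k M : \sum_(k.+1 <= d < M) p d * (Upsilon L a g * rho L a g ^+ d)
  <= Psi L a g p * delta L a g ^+ k.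
Proof.
have d0 := delta_gt0; have d1 := delta_lt1; have r0 := rho_gt0.
have U := Upsilon_ge3; rewrite /Psi; set s := sup _.
have s0 : 0 <= s.
  apply: le_trans (subexp_le_sup 0); rewrite expr0 mulr1.
  by have [p0 _] := p_subexp; exact: p0.
have Us0 : 0 <= Upsilon L a g * s by rewrite mulr_ge0//; lra.
apply: le_trans (_ : \sum_(k.+1 <= d < M)
    Upsilon L a g * s * delta L a g ^+ d <= _).
  apply: ler_sum => d _.
  have h : p d * rho L a g ^+ d <= s * delta L a g ^+ d.
    rewrite -ler_pdivrMr ?exprn_gt0//; apply: le_trans (subexp_le_sup d).
    by rewrite -mulrA -expr_div_n.
  have U0 : 0 <= Upsilon L a g by lra.
  by have := ler_wpM2l U0 h; lra.
rewrite -mulr_sumr.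
have h : \sum_(k.+1 <= d < M) delta L a g ^+ d
    <= delta L a g ^+ k.+1 * (1 - delta L a g)^-1.
  rewrite -{1}[k.+1]add0n big_addn big_mkord.
  under eq_bigr do rewrite exprD mulrC.
  rewrite -mulr_sumr; apply: ler_wpM2l; first by apply: exprn_ge0; exact: ltW.
  by apply: geometric_sum_le; rewrite (ltW d0) d1.
apply: le_trans (ler_wpM2l Us0 h) _; apply: ler_of_eq; rewrite exprS; ring.
Qed.

Lemma kappabar_le kappa : kappabar L a g p <= kappa%:R ->
  Omega L a g ^+ 2 * (L * Psi L a g p * delta L a g ^+ kappa)
    * (L * Psi L a g p + 2 * L * (1 + LP L a * L ^+ 2 / g)) <= 2^-1.
Proof.
have r1 := sqr_rho_lt1; have U := Upsilon_ge3.
(* If [Psi] is 0, the logarithm in [kappabar] is taken of a quotient by 0 and says nothing, but then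
   the left-hand side is 0 as well. *)
have := Psi_ge0; rewrite le_eqVlt => /predU1P[<-|Psi_gt0] hk.
  by rewrite !(mulr0, mul0r).
have P1 := LP_ge1.
set Z := L * Psi L a g p + 2 * L * (1 + LP L a * L ^+ 2 / g).
have Z0 : 0 < Z.
  have P0 : 0 <= LP L a * L ^+ 2 / g.
    by apply: divr_ge0 (ltW g_gt0); apply: mulr_ge0 (sqr_ge0 _); lra.
  have L0 := L_gt0.
  by apply: addr_gt0; [exact: mulr_gt0|apply: mulr_gt0; lra].
have D0 : 0 < 2 * Upsilon L a g ^+ 2 * Psi L a g p * L * Z.
  have U2 : 0 < 2 * Upsilon L a g ^+ 2 by rewrite mulr_gt0// exprn_gt0//; lra.
  by apply: mulr_gt0 Z0; apply: mulr_gt0 L_gt0; exact: mulr_gt0.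
have b0 : 0 < 1 - rho L a g ^+ 2 by rewrite subr_gt0.
have X0 : 0 < (1 - rho L a g ^+ 2) / (2 * Upsilon L a g ^+ 2 * Psi L a g p * L * Z).
  by rewrite divr_gt0.
have d0 := delta_gt0; have lnd : ln (delta L a g) < 0.
  by rewrite ln_lt0// d0 delta_lt1.
move: hk; rewrite /kappabar -/Z mulrC ler_ndivrMr// (mulr_natl _ kappa) -lnXn//.
rewrite ler_ln ?posrE ?exprn_gt0// ler_pdivlMr// => hk.
have -> : Omega L a g ^+ 2 * (L * Psi L a g p * delta L a g ^+ kappa) * Z
  = delta L a g ^+ kappa * (2 * Upsilon L a g ^+ 2 * Psi L a g p * L * Z)
    / (2 * (1 - rho L a g ^+ 2)).
  by rewrite sqr_Omega; field; rewrite gt_eqF.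
by rewrite ler_pdivrMr ?mulr_gt0//; lra.
Qed.

(** All summands of [Gamma] are nonnegative and 1 - beta^2 <= 1, so [Gamma] dominates its term
    quadratic in [Psi], the one that matches the squared truncation error. *)
Lemma Gamma_ge : Omega L a g ^+ 2 * L * (1 + L * LP L a) * Psi L a g p ^+ 2
  <= Gamma L a g p.
Proof.
have P1 := LP_ge1; have Ps := Psi_ge0.
have /andP[b0 b1] := beta_gap_le1.
rewrite /Gamma ler_pdivlMr//.
have L0 := ltW L_gt0; have P0 : 0 <= LP L a by lra.
have W0 : 0 <= Omega L a g ^+ 2 * L * Psi L a g p.
  by apply: mulr_ge0 Ps; exact: mulr_ge0 (sqr_ge0 _) L0.
have LP0 : 0 <= L * LP L a by exact: mulr_ge0.
have LLP0 : 0 <= 1 + L * LP L a by lra.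
have X0 : 0 <= Omega L a g ^+ 2 * L * (1 + L * LP L a) * Psi L a g p ^+ 2.
  apply: mulr_ge0 (sqr_ge0 _); apply: mulr_ge0 LLP0.
  exact: mulr_ge0 (sqr_ge0 _) L0.
apply: le_trans (ler_piMr X0 b1) _.
have -> : Omega L a g ^+ 2 * L * (1 + L * LP L a) * Psi L a g p ^+ 2
  = Omega L a g ^+ 2 * L * Psi L a g p * ((1 + L * LP L a) * Psi L a g p) by ring.
apply: ler_wpM2l => //.
have Y0 : 0 <= (1 + L * LP L a) * (2 * LP L a * L ^+ 2 / g).
  apply: mulr_ge0 LLP0 _; apply: divr_ge0 (ltW g_gt0).
  by apply: mulr_ge0 (sqr_ge0 _); exact: mulr_ge0.
lra.
Qed.

End ConstantBounds.

(** * Block matrices and graph distance *)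

Section Blocks.
Context {F : realType} {N : nat}.

Lemma dot_blocks (s : 'I_N -> nat) (x y : 'cV[F]_(\sum_i s i)) :
  dot x y = \sum_i dot (submxcol x i) (submxcol y i).
Proof.
rewrite /dot -{1}[x]submxcolK -{1}[y]submxcolK tr_mxcol mul_mxrow_mxcol.
by rewrite summxE.
Qed.

Lemma sqr_norm2_blocks (s : 'I_N -> nat) (x : 'cV[F]_(\sum_i s i)) :
  norm2 x ^+ 2 = \sum_i norm2 (submxcol x i) ^+ 2.
Proof. by rewrite sqr_norm2 dot_blocks; apply: eq_bigr => i _; rewrite sqr_norm2. Qed.

Lemma norm2_block_le (s : 'I_N -> nat) (x : 'cV[F]_(\sum_i s i)) i :
  norm2 (submxcol x i) <= norm2 x.
Proof.
rewrite -(@ler_pXn2r _ 2%N) ?nnegrE ?norm2_ge0// sqr_norm2_blocks.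
by rewrite (bigD1 i)//= lerDl sumr_ge0// => j _; exact: sqr_ge0.
Qed.

Lemma submxcol_mulmx (s t : 'I_N -> nat)
    (M : 'M[F]_(\sum_i s i, \sum_i t i)) (x : 'cV[F]_(\sum_i t i)) i :
  submxcol (M *m x) i = \sum_j submxblock M i j *m submxcol x j.
Proof.
rewrite -submxcol_mul -[submxcol M i]submxrowK -{1}[x]submxcolK mul_mxrow_mxcol.
by apply: eq_bigr => j _; rewrite submxblockEv.
Qed.

(** It lets a single block of a matrix be tested by applying the whole matrix to a vector
    concentrated at node [j]. *)
Definition block_proj (s : 'I_N -> nat) j (x : 'cV[F]_(\sum_i s i)) :
  'cV[F]_(\sum_i s i) := \mxcol_i (if i == j then submxcol x i else 0).

Lemma norm2_block_proj (s : 'I_N -> nat) j (x : 'cV[F]_(\sum_i s i)) :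
  norm2 (block_proj j x) = norm2 (submxcol x j).
Proof.
apply/eqP; rewrite -(@eqrXn2 _ 2%N) ?norm2_ge0// sqr_norm2_blocks.
rewrite (bigD1 j)//= mxcolK eqxx big1 ?addr0// => i /negPf ij.
by rewrite mxcolK ij norm2_0 expr0n.
Qed.

Lemma mulmx_block_proj (s t : 'I_N -> nat)
    (M : 'M[F]_(\sum_i s i, \sum_i t i)) (x : 'cV[F]_(\sum_i t i)) i j :
  submxcol (M *m block_proj j x) i = submxblock M i j *m submxcol x j.
Proof.
rewrite submxcol_mulmx (bigD1 j)//= mxcolK eqxx big1 ?addr0// => l /negPf lj.
by rewrite mxcolK lj mulmx0.
Qed.

Lemma weighted_CS (c x : 'I_N -> F) : (forall j, 0 <= c j) ->
  (\sum_j c j * x j) ^+ 2 <= (\sum_j c j) * \sum_j c j * x j ^+ 2.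
Proof.
move=> c0; pose ip (u v : 'cV[F]_N) := \sum_j c j * (u j 0 * v j 0).
have ipP : semi_inner ip.
  split=> [u v|k u v w|u].
  - by apply: eq_bigr => j _; rewrite (mulrC (u j 0)).
  - rewrite mulr_sumr -big_split /=; apply: eq_bigr => j _.
    by rewrite !mxE; ring.
  - by apply: sumr_ge0 => j _; rewrite mulr_ge0// -expr2 sqr_ge0.
have := ip_CS ipP (const_mx 1) (\col_j x j).
rewrite /ip.
under eq_bigr do rewrite !mxE mul1r.
under [X in _ <= X * _]eq_bigr do rewrite !mxE !mulr1.
by under [X in _ <= _ * X]eq_bigr do rewrite !mxE -expr2.
Qed.

Lemma norm2_sum (s : nat) (x : 'I_N -> 'cV[F]_s) :
  norm2 (\sum_j x j) <= \sum_j norm2 (x j).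
Proof.
elim/big_ind2: _ => [|y b z d yb zd|//]; first by rewrite norm2_0.
by apply: le_trans (norm2D _ _) _; exact: lerD.
Qed.

(** Cauchy-Schwarz with weights [c i j] in each row uses the row sums; after exchanging the
    summations, the column sums give the second factor [eps]. *)
Lemma schur_test (s t : 'I_N -> nat) (M : 'M[F]_(\sum_i s i, \sum_i t i))
    (c : 'I_N -> 'I_N -> F) (eps : F) :
  0 <= eps -> (forall i j, 0 <= c i j) ->
  (forall i j x, norm2 (submxblock M i j *m submxcol x j)
     <= c i j * norm2 (submxcol x j)) ->
  (forall i, \sum_j c i j <= eps) -> (forall j, \sum_i c i j <= eps) ->
  bounded_by M eps.
Proof.
move=> e0 c0 Mc rows cols x.
rewrite -(@ler_pXn2r _ 2%N) ?nnegrE ?mulr_ge0 ?norm2_ge0//.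
rewrite exprMn !sqr_norm2_blocks.
have row i : norm2 (submxcol (M *m x) i) ^+ 2
    <= eps * \sum_j c i j * norm2 (submxcol x j) ^+ 2.
  apply: le_trans (_ : (\sum_j c i j * norm2 (submxcol x j)) ^+ 2 <= _).
    rewrite ler_pXn2r ?nnegrE ?norm2_ge0//; last first.
      by apply: sumr_ge0 => j _; rewrite mulr_ge0 ?norm2_ge0.
    rewrite submxcol_mulmx; apply: le_trans (norm2_sum _) _.
    by apply: ler_sum => j _; exact: Mc.
  apply: le_trans (weighted_CS _ (c0 i)) _; apply: ler_wpM2r (rows i).
  by apply: sumr_ge0 => j _; rewrite mulr_ge0 ?sqr_ge0.
apply: le_trans (ler_sum _ (fun i _ => row i)) _.
rewrite -mulr_sumr exchange_big /= expr2 -mulrA ler_wpM2l// mulr_sumr.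
by apply: ler_sum => j _; rewrite -mulr_suml ler_wpM2r ?sqr_ge0.
Qed.

End Blocks.

Section GraphDistance.
Context {F : realType} {N : nat} (e : rel 'I_N).
Hypothesis e_sym : symmetric e.

(** Walks of bounded length stand in for [gdist] in the support argument: one application of a
    banded matrix prepends one edge, with no extended reals involved. *)
Definition reach (j : 'I_N) (k : nat) (i : 'I_N) : Prop :=
  exists w, [/\ path e i w, last i w = j & (size w <= k)%N].

Lemma reach_gdist i j k : reach j k i -> (gdist F e i j <= k%:R%:E)%E.
Proof.
move=> [w [pw lw sw]]; apply: le_trans (_ : _ <= (size w)%:R%:E)%E _.
  by apply: ereal_inf_lbound; exists w.
by rewrite lee_fin ler_nat.
Qed.

(** An infimum over lengths of walks is attained as soon as one walk exists, since lengths are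
    natural numbers. *)
Lemma gdistP i j : gdist F e i j = +oo%E \/ exists d : nat, gdist F e i j = d%:R%:E.
Proof.
have [[w0 pw0]|nopath] := pselect (exists w, path e i w /\ last i w = j); last first.
  left; rewrite /gdist; set S := (X in ereal_inf X).
  suff -> : S = set0 by rewrite ereal_inf0.
  by apply/seteqP; split => // x [w pw _]; apply: nopath; exists w.
have ex : exists d, `[< exists w, [/\ path e i w, last i w = j & size w = d] >].
  by exists (size w0); apply/asboolP; exists w0; case: pw0.
right; case: (ex_minnP ex) => d /asboolP[w [pw lw sw]] dmin; exists d.
apply/eqP; rewrite eq_le; apply/andP; split.
  by apply: ereal_inf_lbound; exists w => //; rewrite sw.
apply/ereal_infP => _ [v [pv lv] <-]; rewrite lee_fin ler_nat.
by apply: dmin; apply/asboolP; exists v.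
Qed.

Lemma gdistC i j : gdist F e i j = gdist F e j i.
Proof.
have le k l : (gdist F e k l <= gdist F e l k)%E.
  apply/ereal_infP => _ [v [pv lv] <-]; apply: ereal_inf_lbound.
  exists (rev (belast l v)); last by rewrite size_rev size_belast.
  split.
    by rewrite -lv rev_path (eq_path (e' := e))// => x y /=; exact: e_sym.
  by case: v pv lv => [|y v] pv lv /=; rewrite ?rev_cons ?last_rcons.
by apply/eqP; rewrite eq_le !le.
Qed.

Definition supported (s : 'I_N -> nat) (j : 'I_N) (k : nat)
    (x : 'cV[F]_(\sum_i s i)) : Prop :=
  forall i, ~ reach j k i -> submxcol x i = 0.

Lemma supported_chain (s : 'I_N -> nat) j : subspace_chain (supported (s := s) j).
Proof.
split=> [k i _|k c x y Sx Sy i ni|k x Sx i ni].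
- by rewrite submxcol0.
- have -> : submxcol (c *: x + y) i = c *: submxcol x i + submxcol y i.
    by apply/matrixP => a b; rewrite !mxE.
  by rewrite Sx ?Sy ?scaler0 ?addr0.
- by apply: Sx => -[w [? ? ?]]; apply: ni; exists w; split=> //; exact: leqW.
Qed.

Lemma supported_block_proj (s : 'I_N -> nat) j (x : 'cV[F]_(\sum_i s i)) :
  supported j 0 (block_proj j x).
Proof.
move=> i ni; rewrite mxcolK; case: eqP => // ij; exfalso; apply: ni.
by exists [::].
Qed.

Definition banded (s t : 'I_N -> nat) (M : 'M[F]_(\sum_i s i, \sum_i t i)) :=
  forall i j, i != j -> ~~ e i j -> submxblock M i j = 0.

Lemma banded_supported (s t : 'I_N -> nat)
    (M : 'M[F]_(\sum_i s i, \sum_i t i)) j k x : banded M ->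
  supported j k x -> supported j k.+1 (M *m x).
Proof.
move=> Mb Sx i ni; rewrite submxcol_mulmx big1// => l _.
have [il|il] := eqVneq i l.
  rewrite Sx ?mulmx0// => -[w [? ? ?]]; apply: ni; exists w.
  by rewrite il; split=> //; exact: leqW.
have [eil|eil] := boolP (e i l); last by rewrite Mb// mul0mx.
rewrite Sx ?mulmx0// => -[w [? ? ?]]; apply: ni; exists (l :: w).
by split=> //=; rewrite eil.
Qed.

Lemma banded_tr (s t : 'I_N -> nat) (M : 'M[F]_(\sum_i s i, \sum_i t i)) :
  banded M -> banded M^T.
Proof.
move=> Mb i j ij eij; have -> : submxblock M^T i j = (submxblock M j i)^T.
  by apply/matrixP => a b; rewrite !mxE.
by rewrite Mb ?trmx0// 1?eq_sym// e_sym.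
Qed.

Section Truncation.
Variables (nx nu : 'I_N -> nat) (K : 'M[F]_(\sum_i nu i, \sum_i nx i)).
Variables (C q Ups r : F) (p : nat -> F) (kappa : nat) (eps : F).
Hypothesis q_bnd : 0 <= q < 1.
Hypotheses (Ups_ge0 : 0 <= Ups) (r_ge0 : 0 <= r) (eps_ge0 : 0 <= eps).
Hypothesis K_local : forall j k x0, supported j 0 x0 ->
  exists2 w, supported j k.*2 w & norm2 (K *m x0 - w) <= C * q ^+ k * norm2 x0.
Hypothesis decay : forall d, (0 < d)%N -> C * q ^+ d.-1./2 <= Ups * r ^+ d.
Hypothesis p_growth : forall i d,
  #|[pred j | gdist F e i j == d%:R%:E]|%:R <= p d.
Hypothesis tail : forall M,
  \sum_(kappa.+1 <= d < M) p d * (Ups * r ^+ d) <= eps.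

(** The local approximant has no component at node [i], so the whole block is approximation
    error. *)
Lemma gain_block_local i j k x : ~ reach j k.*2 i ->
  norm2 (submxblock K i j *m submxcol x j) <= C * q ^+ k * norm2 (submxcol x j).
Proof.
move=> ni; have [w Sw wle] := K_local k (@supported_block_proj _ j x).
rewrite norm2_block_proj in wle; apply: le_trans wle.
apply: le_trans (norm2_block_le _ i).
by rewrite submxcolB mulmx_block_proj Sw// subr0.
Qed.

(** Node [i] is out of reach for every number of steps, so the bound of [gain_block_local] holds for
    all k and tends to 0. *)
Lemma gain_block_disconnected i j x : gdist F e i j = +oo%E ->
  norm2 (submxblock K i j *m submxcol x j) = 0.
Proof.
move=> dinf; apply/eqP; rewrite eq_le norm2_ge0 andbT.
apply: (@le_of_geometric_le _ _ _ (C * norm2 (submxcol x j)) q) => // k.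
rewrite add0r mulrAC; apply: gain_block_local => /reach_gdist.
by rewrite dinf.
Qed.

Lemma gain_block_decay i j d x : (0 < d)%N -> gdist F e i j = d%:R%:E ->
  norm2 (submxblock K i j *m submxcol x j)
    <= Ups * r ^+ d * norm2 (submxcol x j).
Proof.
move=> d0 dd; apply: le_trans (ler_wpM2r (norm2_ge0 _) (decay d0)).
apply: gain_block_local => /reach_gdist; rewrite dd lee_fin ler_nat.
apply/negP; rewrite -ltnNge.
case: d d0 {dd} => [//|d] _ /=; rewrite ltnS -[leqRHS]odd_double_half.
exact: leq_addl.
Qed.

Lemma gdist_bounded : exists M, forall i j d, gdist F e i j = d%:R%:E -> (d < M)%N.
Proof.
have : forall ij : 'I_N * 'I_N, exists M : nat,
    forall d, gdist F e ij.1 ij.2 = d%:R%:E -> (d <= M)%N.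
  move=> [i j] /=; have [->|[d ->]] := gdistP i j; first by exists 0%N.
  by exists d => d' [] /eqP; rewrite eqr_nat => /eqP ->.
move=> /choice[f hf]; exists (\max_ij f ij).+1 => i j d /(hf (i, j)) h.
by rewrite ltnS; apply: leq_trans h _; exact: leq_bigmax.
Qed.

Lemma truncation_error : bounded_by (K - truncated_gain e kappa K) eps.
Proof.
have [M hM] := gdist_bounded.
pose w d := Ups * r ^+ d.
have w0 d : 0 <= w d by rewrite mulr_ge0 ?exprn_ge0.
(* The weight is Ups r^d at a finite distance d > kappa and 0 elsewhere, including disconnected
   pairs. Written as a sum over d, its row sums turn into sphere sizes times weights by exchanging
   the summations. *)
pose b i j := \sum_(kappa.+1 <= d < M) (gdist F e i j == d%:R%:E)%:R * w d.
have b0 i j : 0 <= b i j.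
  by apply: sumr_ge0 => d _; rewrite mulr_ge0.
have rows i : \sum_j b i j <= eps.
  rewrite exchange_big /=; apply: le_trans (tail M); apply: ler_sum => d _.
  rewrite -mulr_suml ler_wpM2r//; apply: le_trans (p_growth i d).
  rewrite -natr_sum -sum1_card; apply: ler_of_eq; congr _%:R.
  rewrite [RHS]big_mkcond /=.
  by apply: eq_bigr => j _; rewrite inE; case: (_ == _).
apply: (@schur_test _ _ _ _ _ b) => //; last first.
  (* Column sums are row sums, because the distance is symmetric. *)
  move=> j; apply: le_trans (rows j); apply: ler_sum => i _.
  by apply: ler_sum => d _; rewrite gdistC.
move=> i j x; rewrite submxblockB mxblockK.
case: ifPn => [_|]; first by rewrite subrr mul0mx norm2_0 mulr_ge0 ?norm2_ge0.
rewrite -ltNge subr0 => kd.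
have [dinf|[d dd]] := gdistP i j.
  by rewrite gain_block_disconnected// mulr_ge0 ?norm2_ge0.
move: kd; rewrite dd lte_fin ltr_nat => kd.
apply: le_trans (gain_block_decay _ (leq_ltn_trans (leq0n _) kd) dd) _.
apply: ler_wpM2r; first exact: norm2_ge0.
rewrite /b (bigD1_seq d) ?iota_uniq//=; last by rewrite mem_index_iota kd (hM _ _ _ dd).
rewrite dd eqxx mul1r lerDl; apply: sumr_ge0 => d' _.
by rewrite mulr_ge0.
Qed.

End Truncation.
End GraphDistance.

(** * The cost gap *)

Section CostGap.
Context {F : realType} {n m : nat}.
Variables (A : 'M[F]_n) (B : 'M[F]_(n, m)) (Q : 'M[F]_n) (R : 'M[F]_m).
Variables (P : 'M[F]_n) (g L Lp c r W : F).
Hypotheses (g_gt0 : 0 < g) (Rg : forall u, g * norm2 u ^+ 2 <= dot u (R *m u)).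
Hypotheses (Qpsd : psd Q) (Rpsd : psd R) (Ppsd : psd P).
Hypothesis Pric : riccati A B Q R P.
Hypotheses (L_ge0 : 0 <= L) (Lp_ge0 : 0 <= Lp).
Hypotheses (AL : bounded_by A L) (BL : bounded_by B L) (RL : bounded_by R L).
Hypothesis PLp : bounded_by P Lp.

Let K := lqr_gain A B R P.

Hypotheses (c_ge0 : 0 <= c) (r_bnd : 0 <= r < 1).
Hypothesis K_decay : forall t, bounded_by ((A - B *m K) ^+ t) (c * r ^+ t).
Hypothesis W_ge : c ^+ 2 / (1 - r ^+ 2) <= W.

(** Only this direction is needed, since the optimal cost enters the gap with a negative sign. Along
    the optimal loop the squares in [cost_partial_sum] vanish and the terminal value decays. *)
Lemma optimal_cost_ge x0 :
  ((2^-1 * dot x0 (P *m x0))%:E <= J A B Q R (linear_policy K) x0)%E.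
Proof.
apply: J_ge => // eps eps0.
have [r0 r1] := andP r_bnd.
have r2 : 0 <= r ^+ 2 < 1 by rewrite sqr_ge0 expr_lt1.
have [T hT] := geometric_small (Lp * c ^+ 2 * norm2 x0 ^+ 2) r2 eps0.
exists T; rewrite (cost_partial_sum g_gt0 Rg Rpsd Ppsd Pric).
rewrite subrr big1 ?addr0; last first.
  by move=> t _; rewrite !mul0mx; exact: ip0l.
set x := state _ _ _ _ _.
have h : dot x (P *m x) <= eps.
  apply: le_trans hT; apply: le_trans (psd_dot_le x PLp) _.
  have -> : Lp * c ^+ 2 * norm2 x0 ^+ 2 * (r ^+ 2) ^+ T
    = Lp * ((c * r ^+ T) ^+ 2 * norm2 x0 ^+ 2).
    have -> : (r ^+ 2) ^+ T = (r ^+ T) ^+ 2 by rewrite -!exprM mulnC.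
    by ring.
  apply: ler_wpM2l => //; rewrite /x state_linear; apply: sqr_bounded_by => //.
  by apply: mulr_ge0 => //; exact: exprn_ge0.
have := psd_ge0 x Ppsd; lra.
Qed.

Variables (K' : 'M[F]_(m, n)) (eps : F).
Hypotheses (eps_ge0 : 0 <= eps) (K'_eps : bounded_by (K - K') eps).
Hypothesis small : W * (2 * (L * (1 + Lp * L ^+ 2 / g)) * (L * eps)
  + (L * eps) ^+ 2) <= 4^-1.

Lemma cost_gap x0 :
  (J A B Q R (linear_policy K') x0 - J A B Q R (linear_policy K) x0
   <= ((L + L ^+ 2 * Lp) * eps ^+ 2 * W * norm2 x0 ^+ 2)%:E)%E.
Proof.
set G := _ * norm2 x0 ^+ 2.
have upper : (J A B Q R (linear_policy K') x0
    <= (2^-1 * dot x0 (P *m x0) + G)%:E)%E.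
  apply: J_le => // T; rewrite (cost_partial_sum g_gt0 Rg Rpsd Ppsd Pric).
  set x := state A B (linear_policy K') x0.
  (* The truncated loop is the optimal one perturbed by D = -B (K - K'), of norm at most L eps. *)
  have xS t : x t.+1 = (A - B *m K - - (B *m (K - K'))) *m x t.
    rewrite opprK mulmxBr addrA subrK /x /= /linear_policy mulmxN.
    by rewrite mulmxBl mulmxA.
  have sumx : \sum_(t < T) norm2 (x t) ^+ 2 <= 2 * W * norm2 x0 ^+ 2.
    apply: (perturbed_loop_sum c_ge0 r_bnd K_decay W_ge _ _ _ _ small xS).
    - apply: mulr_ge0 => //; apply: addr_ge0 => //.
      by apply: divr_ge0 (ltW g_gt0); exact: mulr_ge0 (sqr_ge0 _).
    - exact: mulr_ge0.
    - exact: closed_loop_bound.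
    - move=> y; rewrite mulNmx norm2N.
      exact: bounded_by_mul L_ge0 BL K'_eps y.
  have L2 : 0 <= L + L ^+ 2 * Lp by rewrite addr_ge0// mulr_ge0 ?sqr_ge0.
  have term (t : 'I_T) : dot ((K - K') *m x t)
      ((R + B^T *m P *m B) *m ((K - K') *m x t))
      <= (L + L ^+ 2 * Lp) * eps ^+ 2 * norm2 (x t) ^+ 2.
    apply: le_trans (psd_dot_le _ _) _.
      exact: (input_hessian_bound L_ge0 Lp_ge0 BL RL PLp).
    by rewrite -mulrA ler_wpM2l//; exact: sqr_bounded_by.
  have h : \sum_(t < T) dot ((K - K') *m x t)
      ((R + B^T *m P *m B) *m ((K - K') *m x t))
      <= (L + L ^+ 2 * Lp) * eps ^+ 2 * \sum_(t < T) norm2 (x t) ^+ 2.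
    by rewrite mulr_sumr; apply: ler_sum => t _; exact: term.
  have k0 : 0 <= (L + L ^+ 2 * Lp) * eps ^+ 2 by rewrite mulr_ge0 ?sqr_ge0.
  have := ler_wpM2l k0 sumx; have := psd_ge0 (x T) Ppsd.
  by rewrite /G; lra.
apply: le_trans (leeB upper (optimal_cost_ge x0)) _.
by rewrite -EFinB lee_fin addrAC subrr add0r.
Qed.

End CostGap.

Theorem theorem4p2 (F : realType) (N : nat) (e : rel 'I_N)
    (e_sym : symmetric e) (e_irr : irreflexive e)
    (nx nu : 'I_N -> nat)
    (A_ : forall i j : 'I_N, 'M[F]_(nx i, nx j))
    (B_ : forall i j : 'I_N, 'M[F]_(nx i, nu j))
    (Q_ : forall i j : 'I_N, 'M[F]_(nx i, nx j))
    (R_ : forall i j : 'I_N, 'M[F]_(nu i, nu j))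
    (Q_sym : forall i j, Q_ i j = (Q_ j i)^T)
    (R_sym : forall i j, R_ i j = (R_ j i)^T)
    (local : forall i j, i != j -> ~~ e i j ->
       [/\ A_ i j = 0, B_ i j = 0, Q_ i j = 0 & R_ i j = 0])
    (L a g : F) (p : nat -> F) :
  let A := \mxblock_(i, j) A_ i j in
  let B := \mxblock_(i, j) B_ i j in
  let Q := \mxblock_(i, j) Q_ i j in
  let R := \mxblock_(i, j) R_ i j in
  1 < L -> 0 < a < 1 -> 0 < g < 1 ->
  [/\ opnorm A <= L, opnorm B <= L, opnorm Q <= L & opnorm R <= L] ->
  loewner_ge R g%:M ->
  stabilizable L a A B ->
  psd Q ->
  forall Qhalf, is_sqrtm Q Qhalf -> detectable L a A Qhalf ->
  subexponential p ->
  (forall (i : 'I_N) (d : nat),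
     #|[pred j | gdist F e i j == d%:R%:E]|%:R <= p d) ->
  forall Pstar, psd Pstar -> riccati A B Q R Pstar ->
  let Kstar := lqr_gain A B R Pstar in
  forall kappa : nat, kappabar L a g p <= kappa%:R ->
  forall x0 : 'cV[F]_(\sum_i nx i),
  (J A B Q R (linear_policy (truncated_gain e kappa Kstar)) x0
   - J A B Q R (linear_policy Kstar) x0
   <= (Gamma L a g p * delta L a g ^+ kappa * norm2 x0 ^+ 2)%:E)%E.
Proof.
move=> A B Q R L1 a01 g01 [An Bn Qn Rn] Rge [Kb Kbn Kbs] Qpsd C [[Cs _] CC].
move=> [Kd Kdn Kds] psub pg P Ppsd Pric K kappa hkappa x0.
have [[a0 a1] [g0 g1]] := (andP a01, andP g01).
have L0 : 0 <= L by lra.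
have a_bnd : 0 <= a < 1 by rewrite ltW.
have [Rsym Rge0] := Rge.
have Rg u : g * norm2 u ^+ 2 <= dot u (R *m u).
  have := Rge0 u; rewrite -mulmxA mulmxBl mul_scalar_mx -/(dot _ _).
  by rewrite (ipDr (dotP _)) (ipNr (dotP _)) (ipZr (dotP _)) -sqr_norm2 subr_ge0.
have Rpsd : psd R.
  split=> [|u]; last first.
    by rewrite -mulmxA; apply: le_trans (Rg u); rewrite mulr_ge0 ?sqr_ge0// ltW.
  by move: Rsym; rewrite linearB /= tr_scalar_mx => /addIr.
have QC x : dot x (Q *m x) = norm2 (C *m x) ^+ 2.
  by rewrite sqr_norm2 dot_mulmx Cs mulmxA CC.
have [AL BL] := (bounded_by_opnorm An, bounded_by_opnorm Bn).
have [QL RL] := (bounded_by_opnorm Qn, bounded_by_opnorm Rn).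
have [KbL KdL] := (bounded_by_opnorm Kbn, bounded_by_opnorm Kdn).
have Kb_stable t := bounded_by_opnorm (Kbs t).
have Kd_stable t := bounded_by_opnorm (Kds t).
have PLp : bounded_by P (LP L a).
  exact: (riccati_bound g0 Rg Rpsd Ppsd Pric L0 a_bnd QL RL KbL Kb_stable).
have Lp1 := LP_ge1 L1 a01.
have H0 := gammaH_gt0 L1 a01 g01; have H1 := gammaH_le1 L1 a01 g01.
have LH3 := LH_ge3 a L1; have LHP := LH_ge_LP L a.
have lo0 : 0 < 3 * gammaH L a g by rewrite mulr_gt0.
have lohi : 3 * gammaH L a g < 3 * LH L a by lra.
have lo_le : 16 * (L / (1 - a)) ^+ 2 * LP L a / g <= (3 * gammaH L a g)^-1.
  by have := gammaH_inv_ge L1 a01 g01; rewrite invfM; lra.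
have hi_ge : 3 * LP L a <= 3 * LH L a by lra.
have g_bnd : 0 < g <= 1 by rewrite g0 ltW.
(* The common factor 3 of the two bounds on the KKT operator drops out, so the contraction factor is
   exactly rho^2. *)
have qE : ((3 * LH L a) ^+ 2 - (3 * gammaH L a g) ^+ 2)
    / ((3 * LH L a) ^+ 2 + (3 * gammaH L a g) ^+ 2) = rho L a g ^+ 2.
  have d0 : 0 < LH L a ^+ 2 + gammaH L a g ^+ 2.
    by rewrite addr_gt0 ?exprn_gt0//; lra.
  rewrite (sqr_rho L1 a01 g01).
  have -> : (3 * LH L a) ^+ 2 - (3 * gammaH L a g) ^+ 2
    = 9 * (LH L a ^+ 2 - gammaH L a g ^+ 2) by ring.
  have -> : (3 * LH L a) ^+ 2 + (3 * gammaH L a g) ^+ 2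
    = 9 * (LH L a ^+ 2 + gammaH L a g ^+ 2) by ring.
  by rewrite -mulf_div mulfV ?mul1r.
have r0 := rho_gt0 L1 a01 g01; have r1 := rho_lt1 L1 a01 g01.
have U3 := Upsilon_ge3 L1 a01 g01.
have bands : [/\ banded e A, banded e B, banded e Q & banded e R].
  by split=> i j ij eij; rewrite mxblockK; have [] := local i j ij eij.
have [bA bB bQ bR] := bands.
have K_local j k y : supported e j 0 y -> exists2 w, supported e j k.*2 w &
    norm2 (K *m y - w) <= (3 * gammaH L a g)^-1 * (rho L a g ^+ 2) ^+ k * norm2 y.
  move=> y0; rewrite -qE [_^-1 * _]mulrC.
  exact: (optimal_gain_local Qpsd Rpsd Ppsd (ltW L1) a_bnd g_bnd (LP_ge L1 a01)
    AL BL QL RL PLp Rg QC KbL KdL Kb_stable Kd_stable Pric lo0 lohi lo_le hi_ge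
    (supported_chain e nx j) (supported_chain e nu j)
    (fun k x => banded_supported bA) (fun k x => banded_supported (banded_tr e_sym bA))
    (fun k x => banded_supported bQ) (fun k x => banded_supported bB)
    (fun k x => banded_supported (banded_tr e_sym bB))
    (fun k x => banded_supported bR) k y0).
have K_decay t : bounded_by ((A - B *m K) ^+ t) (Upsilon L a g / 2 * rho L a g ^+ t).
  case: t => [|t] y.
    by rewrite !expr0 mul1mx mulr1 ler_peMl ?norm2_ge0//; lra.
  apply: le_trans (ler_wpM2r (norm2_ge0 _) (decay_constant L1 a01 g01 (ltn0Sn t))).
  rewrite -qE /=.
  have all_chain k : @subspace_chain _ _ (fun (_ : nat) (_ : 'cV[F]_k) => True).
    by [].
  apply: (optimal_state_decay Qpsd Rpsd Ppsd (ltW L1) a_bnd g_bnd (LP_ge L1 a01)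
    AL BL QL RL PLp Rg QC KbL KdL Kb_stable Kd_stable Pric lo0 lohi lo_le hi_ge
    (all_chain _) (all_chain _)) => //.
  by rewrite ltnS -[leqRHS]odd_double_half leq_addl.
have d0 := delta_gt0 L1 a01 g01; have d1 := delta_lt1 L1 a01 g01.
have Ps := Psi_ge0 L1 a01 g01 psub.
set eps := Psi L a g p * delta L a g ^+ kappa.
have eps0 : 0 <= eps by apply: mulr_ge0 => //; exact: exprn_ge0 (ltW d0).
have decay d : (0 < d)%N -> (3 * gammaH L a g)^-1 * (rho L a g ^+ 2) ^+ d.-1./2
    <= Upsilon L a g * rho L a g ^+ d.
  move=> /(decay_constant L1 a01 g01); rewrite mulrC => h; apply: le_trans h _.
  by rewrite ler_wpM2r ?exprn_ge0// ?ltW//; lra.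
have U0 : 0 <= Upsilon L a g by lra.
have K_eps : bounded_by (K - truncated_gain e kappa K) eps.
  apply: (truncation_error e_sym _ U0 (ltW r0) eps0 K_local decay pg).
    by rewrite sqr_ge0 (sqr_rho_lt1 L1 a01 g01).
  exact: subexp_tail_le.
have Om := sqr_Omega L1 a01 g01.
(* The halved [Upsilon] in [K_decay] makes the Lyapunov constant a quarter of Omega^2. *)
have W_ge : (Upsilon L a g / 2) ^+ 2 / (1 - rho L a g ^+ 2) <= Omega L a g ^+ 2 / 4.
  by apply: ler_of_eq; rewrite Om; field; rewrite subr_eq0 gt_eqF// sqr_rho_lt1.
have small := kappabar_le L1 a01 g01 psub hkappa.
rewrite -[L * _ * delta L a g ^+ kappa]mulrA -/eps in small.
have dk1 : delta L a g ^+ kappa <= 1 by rewrite exprn_ile1// ltW.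
have dk0 : 0 <= delta L a g ^+ kappa by rewrite exprn_ge0// ltW.
have eps_Psi : eps <= Psi L a g p by rewrite ler_piMr.
have L2 : 0 <= L + L ^+ 2 * LP L a by rewrite addr_ge0// mulr_ge0 ?sqr_ge0//; lra.
apply: le_trans (cost_gap g0 Rg Qpsd Rpsd Ppsd Pric L0 (le_trans ler01 Lp1)
  AL BL RL PLp _ _ K_decay W_ge eps0 K_eps _ x0) _.
- by rewrite mulr_ge0 ?invr_ge0.
- by rewrite (ltW r0) r1.
(* The condition on kappa bounds this product with L Psi in place of L eps in its last factor; the
   replacement is allowed because delta^kappa <= 1. *)
- have -> : Omega L a g ^+ 2 / 4 * (2 * (L * (1 + LP L a * L ^+ 2 / g)) * (L * eps)
      + (L * eps) ^+ 2) = 4^-1 * (Omega L a g ^+ 2 * (L * eps)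
      * (L * eps + 2 * L * (1 + LP L a * L ^+ 2 / g))) by ring.
  set z := (X in 4^-1 * X); suff : z <= 2^-1 by lra.
  apply: le_trans small; apply: ler_wpM2l.
    by apply: mulr_ge0; [exact: sqr_ge0|exact: mulr_ge0].
  by rewrite lerD2r ler_wpM2l.
rewrite lee_fin; apply: ler_wpM2r; first exact: sqr_ge0.
apply: le_trans (ler_wpM2r dk0 (Gamma_ge L1 a01 g01 psub)).
(* Of the two factors delta^kappa in eps^2, one gives the claimed rate; the other, together with
   1/4, is estimated by 1. *)
have -> : (L + L ^+ 2 * LP L a) * eps ^+ 2 * (Omega L a g ^+ 2 / 4)
  = Omega L a g ^+ 2 * L * (1 + L * LP L a) * Psi L a g p ^+ 2
    * delta L a g ^+ kappa * (delta L a g ^+ kappa / 4) by rewrite /eps; ring.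
rewrite ler_piMr//; last lra.
have LL : 0 <= 1 + L * LP L a by rewrite addr_ge0// mulr_ge0//; lra.
exact: mulr_ge0 (mulr_ge0 (mulr_ge0 (mulr_ge0 (sqr_ge0 _) L0) LL) (sqr_ge0 _)) dk0.
Qed.
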